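(* Let $H$ be a semisimple Hopf algebra of even dimension $n$ over $\mathbb C$ and let $S$ be its antipode. Then there exists an irreducible character $\chi$ of $H$ with $\chi=\chi^*\neq\varepsilon$ such that $$\deg(\chi)\le\frac{n-1}{|\operatorname{Tr}(S)-1|}.$$ Moreover, if $\operatorname{Tr}(S)>1$ then $\nu_2(\chi)=1$, and if $\operatorname{Tr}(S)<1$ then $\nu_2(\chi)=-1$.
   Context: $H$ is finite-dimensional with counit $\varepsilon$. Irreducible characters are the characters of simple $H$-modules; $\deg(\chi)=\chi(1_H)$; $\chi^*=\chi\circ S$ is the character of the dual module, and $\varepsilon$ is the character of the trivial module. The second Frobenius-Schur indicator of an irreducible character is $\nu_2(\chi)=\chi(\Lambda_1\Lambda_2)$, where $\Lambda\in H$ is the integral with $\varepsilon(\Lambda)=1$ and $\Delta(\Lambda)=\Lambda_1\otimes\Lambda_2$ (Sweedler notation). Under the hypotheses $\operatorname{Tr}(S)$ is an even integer, so $\operatorname{Tr}(S)\ne1$ and the bound is well-defined. The ''moreover'' clause refers to the character $\chi$ whose existence is asserted: $\chi$ can be chosen to satisfy both the degree bound and the stated indicator value. *)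

(* Defs.v *)
From HB Require Import structures.
From mathcomp Require Import all_boot all_order all_algebra all_field.
From mathcomp Require Import boolp classical_sets reals complex.

Set Implicit Arguments.
Unset Strict Implicit.
Unset Printing Implicit Defensive.

Import Order.TTheory GRing.Theory Num.Theory.
Local Open Scope ring_scope.

(* The tensor product of two finite-dimensional spaces, as the space of       *)
(* coefficient matrices in the bases vbasis of U and V: the pure tensor       *)
(* u (x) v is the rank-one matrix of the products of the coordinates.         *)
(* The lemmas tlift_pure and tensor_ext below are its universal property.     *)
Section Tensor.
Variable K : fieldType.

Definition tensor (U V : vectType K) : vectType K :=
  'M[K]_(\dim {:U}, \dim {:V}).

Definition pure (U V : vectType K) (u : U) (v : V) : tensor U V :=
  \matrix_(i, j) (coord (vbasis {:U}) i u * coord (vbasis {:V}) j v).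

(* The linear map on U (x) V that a bilinear map B on U * V induces:          *)
(* in Sweedler notation, tlift B (sum u_1 (x) u_2) = sum (B u_1 u_2).         *)
Definition tlift (U V W : vectType K) (B : U -> V -> W) (t : tensor U V) : W :=
  \sum_i \sum_j (t : 'M_(_, _)) i j *:
    B (vbasis {:U})`_i (vbasis {:V})`_j.

Definition tmap (U V U' V' : vectType K) (f : U -> U') (g : V -> V') :
    tensor U V -> tensor U' V' :=
  tlift (fun u v => pure (f u) (g v)).

Definition tassoc (U V W : vectType K) :
    tensor (tensor U V) W -> tensor U (tensor V W) :=
  tlift (fun t w => tlift (fun u v => pure u (pure v w)) t).

Definition tmul (A : falgType K) (s t : tensor A A) : tensor A A :=
  tlift (fun a b => tlift (fun c d => pure (a * c) (b * d)) t) s.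

Section Theory.
Variables U V W : vectType K.

Lemma pure_linearl (v : V) : linear (fun u : U => pure u v).
Proof.
by move=> k u u'; apply/matrixP=> i j; rewrite !mxE linearP mulrDl mulrA.
Qed.

Lemma pure_linearr (u : U) : linear (pure u : V -> tensor U V).
Proof.
by move=> k v v'; apply/matrixP=> i j; rewrite !mxE linearP mulrDr mulrCA.
Qed.

Lemma tlift_linear (B : U -> V -> W) : linear (tlift B).
Proof.
move=> k s t; rewrite /tlift scaler_sumr -big_split /=; apply: eq_bigr => i _.
rewrite scaler_sumr -big_split /=; apply: eq_bigr => j _.
by rewrite !mxE scalerDl scalerA.
Qed.

Lemma tlift_pure (B : U -> V -> W) u v :
    (forall v, linear (B^~ v)) -> (forall u, linear (B u)) ->
  tlift B (pure u v) = B u v.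
Proof.
move=> Bl Br.
pose Bl' x : {linear U -> W} := HB.pack (B^~ x)
  (GRing.isSemilinear.Build K U W _ (B^~ x) (GRing.semilinear_linear (Bl x))).
pose Br' x : {linear V -> W} := HB.pack (B x)
  (GRing.isSemilinear.Build K V W _ (B x) (GRing.semilinear_linear (Br x))).
rewrite {2}(coord_vbasis (memvf u)) -[RHS]/(Bl' v _) linear_sum.
apply: eq_bigr => i _; rewrite linearZ /= {2}(coord_vbasis (memvf v)).
rewrite -[B _ _]/(Br' _ _) linear_sum scaler_sumr.
by apply: eq_bigr => j _; rewrite linearZ /= scalerA mxE.
Qed.

Lemma tensor_ext (f g : {linear tensor U V -> W}) :
  (forall u v, f (pure u v) = g (pure u v)) -> f =1 g.
Proof.
move=> fg t; rewrite [t]matrix_sum_delta !linear_sum; apply: eq_bigr => i _.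
rewrite !linear_sum; apply: eq_bigr => j _; rewrite !linearZ /=.
suff -> : delta_mx i j = pure (vbasis {:U})`_i (vbasis {:V})`_j by rewrite fg.
apply/matrixP=> k l; rewrite !mxE !coord_free ?(basis_free (vbasisP _)) //.
by rewrite -natrM mulnb (eq_sym i) (eq_sym j).
Qed.

End Theory.

Lemma tmul_pure (A : falgType K) (a b c d : A) :
  tmul (pure a b) (pure c d) = pure (a * c) (b * d).
Proof.
have inner (x y : A) :
    tlift (fun c d => pure (x * c) (y * d)) (pure c d) = pure (x * c) (y * d).
  by apply: tlift_pure => [w|w] k u v; rewrite mulrDr -scalerAr;
    [apply: pure_linearl | apply: pure_linearr].
rewrite /tmul; under [tlift _ _]eq_bigr => i _.
  under eq_bigr => j _ do rewrite inner. over.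
rewrite -[LHS]/(tlift (fun a b => pure (a * c) (b * d)) (pure a b)).
by apply: tlift_pure => [w|w] k u v; rewrite mulrDl -scalerAl;
  [apply: pure_linearl | apply: pure_linearr].
Qed.

End Tensor.

HB.mixin Record Falgebra_isHopf (K : fieldType) (H : Type)
    of Falgebra K H := {
  comul : 'Hom(H, tensor H H);
  counit : 'Hom(H, K^o);
  antipode : 'End(H);
  comulA : forall h : H,
    tassoc (tmap comul id (comul h)) = tmap id comul (comul h);
  counitl : forall h : H,
    tlift (fun a b : H => (counit a : K) *: b) (comul h) = h;
  counitr : forall h : H,
    tlift (fun a b : H => (counit b : K) *: a) (comul h) = h;
  comul1 : comul 1 = pure 1 1;
  comulM : {morph comul : g h / g * h >-> tmul g h};
  counit1 : counit 1 = 1;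
  counitM : {morph counit : g h / g * h >-> (g : K) * h};
  antipodel : forall h : H,
    tlift (fun a b : H => antipode a * b) (comul h) = (counit h : K) *: 1;
  antipoder : forall h : H,
    tlift (fun a b : H => a * antipode b) (comul h) = (counit h : K) *: 1
}.

#[short(type="hopfAlgType")]
HB.structure Definition Hopf (K : fieldType) :=
  { H of Falgebra K H & Falgebra_isHopf K H }.

Definition lftrace (K : fieldType) (V : vectType K) (f : 'End(V)) : K :=
  \sum_(i < \dim {:V}) coord (vbasis {:V}) i (f (vbasis {:V})`_i).

Record amodule (K : fieldType) (A : falgType K) := AModule {
  carrier :> vectType K;
  act : 'Hom(A, 'End(carrier));
  act1 : act 1 = \1%VF;
  actM : forall a b : A, act (a * b) = (act a \o act b)%VF
}.

Section Modules.
Variables (K : fieldType) (A : falgType K).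

Definition submodule (M : amodule A) (U : {vspace M}) : Prop :=
  forall a : A, (act M a @: U <= U)%VS.

Definition simple_module (M : amodule A) : Prop :=
  ({:M} != 0)%VS /\
  forall U : {vspace M}, submodule U -> U = 0%VS \/ U = {:M}%VS.

Definition semisimple_module (M : amodule A) : Prop :=
  forall U : {vspace M}, submodule U ->
  exists W : {vspace M},
    [/\ submodule W, (U + W)%VS = {:M}%VS & (U :&: W)%VS = 0%VS].

Definition regular_act : 'Hom(A, 'End(A)) := linfun (@amull K A).

Fact regular_act1 : regular_act 1 = \1%VF.
Proof. by rewrite lfunE /= amull1. Qed.

Fact regular_actM (a b : A) :
  regular_act (a * b) = (regular_act a \o regular_act b)%VF.
Proof.
have actE c : regular_act c = amull c by rewrite lfunE.
by apply/lfunP => x; rewrite comp_lfunE !actE !lfunE /= mulrA.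
Qed.

Definition regular_module : amodule A := AModule regular_act1 regular_actM.

Definition semisimple_algebra : Prop := semisimple_module regular_module.

Definition character (M : amodule A) (a : A) : K := lftrace (act M a).

(* Simple A-modules are cyclic, hence finite-dimensional like A, so ranging   *)
(* over amodule A loses none of them.                                         *)
Definition irreducible_char (chi : A -> K) : Prop :=
  exists2 M : amodule A, simple_module M & chi = character M.

Definition char_deg (chi : A -> K) : K := chi 1.

End Modules.

Section HopfCharacters.
Variables (K : fieldType) (H : hopfAlgType K).

Definition dual_char (chi : H -> K) : H -> K := fun h => chi (antipode h).

Definition integral (x : H) : Prop :=
  forall h : H, h * x = (counit h : K) *: x /\ x * h = (counit h : K) *: x.

Definition normalized_integral (x : H) : Prop :=
  integral x /\ counit x = 1.

Lemma normalized_integral_uniq (x y : H) :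
  normalized_integral x -> normalized_integral y -> x = y.
Proof.
move=> [Ix ex] [Iy ey]; have [_ xy] := Ix y; have [xy' _] := Iy x.
by move: xy'; rewrite xy ex ey !scale1r.
Qed.

(* The normalized integral, unique by the lemma above; by Maschke's theorem   *)
(* it exists if and only if H is semisimple, otherwise the value is 0.        *)
Definition Lambda : H := xget 0 [set x | normalized_integral x]%classic.

Definition nu2 (chi : H -> K) : K :=
  chi (tlift (fun a b : H => a * b) (comul Lambda)).

End HopfCharacters.

Arguments Lambda {K} H.

(* Main.v *)
(* Tr(S) = sum_chi nu_2(chi) deg(chi), with nu_2(chi) in {0, 1, -1}, nonzero
   only for self-dual chi (Linchenko-Montgomery), and n = sum_chi deg(chi)^2.
   Since S is an involution, Tr(S) = n mod 2, so Tr(S) <> 1. If every chi <> eps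
   whose indicator is s, the sign of Tr(S) - 1, had deg(chi) |Tr(S) - 1| > n - 1,
   then multiplying |Tr(S) - 1| <= sum_{nu_2(chi) = s} deg(chi) by n would give
   n |Tr(S) - 1| <= (n - 1) |Tr(S) - 1|.

   All of this rests on S^2 = 1 (Larson-Radford), obtained as follows. Let Lam be
   the normalized integral and T = S^-1. From
   Lam_1 h (x) Lam_2 = Lam_1 (x) Lam_2 S(h) one gets that S is injective and that
   S^2 fixes the center, hence T^2 = Ad(g) on each matrix block. The functional
   lam(h) = Tr(x |-> h T^2(x)) satisfies lam(h_1) h_2 = lam(h) 1, lam(Lam) = 1 and
   is nondegenerate, and lam o S = lam(_ G) for a grouplike G, so that
   x G = G T^4(x). As G has finite order, g can be scaled to have finite order,
   whence tr(g^-1) is the conjugate of tr(g) and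
   lam(1) = Tr(S^2) = sum |tr g|^2 is nonzero. This forces G = 1 and S^4 = 1.
   Finally e = chi_H / n is an idempotent of the convolution algebra H^*, and the
   trace of the partial involution x |-> S^2(x_1) e(x_2) is Tr(S^2) / n. Thus the
   nonzero integer Tr(S^2) is divisible by n, and since S^2 is an involution of an
   n-dimensional space fixing 1, S^2 = 1. *)
From HB Require Import structures.
Require Import Defs.
From mathcomp Require Import all_boot all_order all_algebra all_field.
From mathcomp Require Import boolp classical_sets reals complex.
From mathcomp Require Import zify ring.

Set Implicit Arguments.
Unset Strict Implicit.
Unset Printing Implicit Defensive.

Import Order.TTheory GRing.Theory Num.Theory.
Local Open Scope ring_scope.

(** * Traces of endomorphisms *)

Section Trace.
Variables (K : fieldType) (V : vectType K).

(** Expand each [y i] in the chosen basis and exchange the sums. The trace can thus be read off any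
    expansion into rank-one maps; the [y i] need not be independent. *)
Lemma lftrace_finrank (I : finType) (f : 'End(V)) (c : I -> {scalar V})
    (y : I -> V) :
  (forall x, f x = \sum_i c i x *: y i) -> lftrace f = \sum_i c i (y i).
Proof.
move=> fE; rewrite /lftrace.
under eq_bigr => j _ do rewrite fE linear_sum /=.
rewrite exchange_big; apply: eq_bigr => i _ /=.
rewrite {2}(coord_vbasis (memvf (y i))) linear_sum; apply: eq_bigr => j _.
by rewrite !linearZ /= mulrC.
Qed.

Lemma lftrace_basis (I : finType) (f : 'End(V)) (c : I -> {scalar V})
    (y : I -> V) :
  (forall x, x = \sum_i c i x *: y i) -> lftrace f = \sum_i c i (f (y i)).
Proof.
move=> yE; apply: lftrace_finrank => x.
by rewrite {1}(yE x) linear_sum; apply: eq_bigr => i _; rewrite linearZ.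
Qed.

Lemma lftraceD (f g : 'End(V)) : lftrace (f + g) = lftrace f + lftrace g.
Proof.
by rewrite /lftrace -big_split; apply: eq_bigr => i _; rewrite add_lfunE linearD.
Qed.

Lemma lftraceZ a (f : 'End(V)) : lftrace (a *: f) = a * lftrace f.
Proof.
by rewrite /lftrace mulr_sumr; apply: eq_bigr => i _; rewrite scale_lfunE linearZ.
Qed.

Lemma lftraceC (f g : 'End(V)) : lftrace (f \o g)%VF = lftrace (g \o f)%VF.
Proof.
pose c i : {scalar V} := coord (vbasis {:V}) i \o f.
rewrite [RHS](@lftrace_finrank _ _ c (fun i => g (vbasis {:V})`_i)).
  by apply: eq_bigr => i _; rewrite /c comp_lfunE.
move=> x; rewrite comp_lfunE {1}(coord_vbasis (memvf (f x))) linear_sum.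
by apply: eq_bigr => i _; rewrite linearZ.
Qed.

Lemma lftrace_sum (I : finType) (f : I -> 'End(V)) :
  lftrace (\sum_i f i) = \sum_i lftrace (f i).
Proof.
apply: (big_morph (fun f : 'End(V) => lftrace f) lftraceD).
by rewrite -(scale0r (\1 : 'End(V))%VF) lftraceZ mul0r.
Qed.

Lemma lftrace1 : lftrace (\1 : 'End(V))%VF = (\dim {:V})%:R.
Proof.
rewrite /lftrace (eq_bigr (fun=> 1)) ?sumr_const ?card_ord // => i _.
by rewrite lfunE coord_free ?eqxx ?(basis_free (vbasisP _)).
Qed.

(** [p] is the identity on its image, so in the rank-one expansion along a basis of [limg p] every
    term contributes 1. *)
Lemma lftrace_idem (p : 'End(V)) :
  (p \o p)%VF = p -> lftrace p = (\dim (limg p))%:R.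
Proof.
move=> pp; pose c i : {scalar V} := coord (vbasis (limg p)) i \o p.
rewrite (@lftrace_finrank _ p c (fun i => (vbasis (limg p))`_i)); last first.
  by move=> x; rewrite {1}(coord_vbasis (memv_img p (memvf x))).
rewrite (eq_bigr (fun=> 1)) ?sumr_const ?card_ord // => i _ /=.
have /memv_imgP[x _ yE]: (vbasis (limg p))`_i \in limg p.
  by rewrite vbasis_mem ?mem_nth ?size_tuple.
rewrite yE -[p (p x)]comp_lfunE pp -yE coord_free ?eqxx //.
exact: basis_free (vbasisP _).
Qed.

End Trace.

Section Involution.
Variables (K : fieldType) (V : vectType K).
Hypothesis two_neq0 : 2 != 0 :> K.

(* m is the dimension of the -1 eigenspace, the image of [(1 - f) / 2]. *)
Lemma lftrace_involution (f : 'End(V)) : (f \o f = \1)%VF ->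
  exists2 m : nat, lftrace f = (\dim {:V})%:R - (m.*2)%:R &
    [/\ (m <= \dim {:V})%N, m = 0%N -> f = \1%VF &
        m = \dim {:V} -> f = (- \1)%VF].
Proof.
move=> ff; pose p : 'End(V) := 2^-1 *: (\1 - f)%VF.
have ffE x : f (f x) = x by rewrite -comp_lfunE ff lfunE.
have pE x : p x = 2^-1 *: (x - f x).
  by rewrite /p scale_lfunE add_lfunE opp_lfunE id_lfunE.
have half_half (x : V) : 2^-1 *: x + 2^-1 *: x = x.
  by rewrite -scalerDl -mulr2n -[_^-1]mulr1 -mulrnAr mulVf ?scale1r.
have fp x : f (2^-1 *: (x - f x)) = - (2^-1 *: (x - f x)).
  by rewrite linearZ -scalerN linearB /= ffE opprB.
have half_half2 x : 2^-1 *: (x + x) = x :> V by rewrite scalerDr half_half.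
have pp : (p \o p)%VF = p.
  by apply/lfunP => x; rewrite comp_lfunE {1}pE [p x]pE fp opprK half_half2.
exists (\dim (limg p)).
  rewrite -muln2 natrM -lftrace_idem // /p lftraceZ mulrC mulrA divff // mul1r.
  by rewrite lftraceD lftrace1 -scaleN1r lftraceZ mulN1r opprB addrC subrK.
split; first exact/dimvS/subvf.
- move/eqP; rewrite dimv_eq0 => /eqP p0; apply/lfunP => x; rewrite id_lfunE.
  have: p x \in limg p by rewrite memv_img ?memvf.
  rewrite p0 memv0 pE scaler_eq0 invr_eq0 (negPf two_neq0) /= subr_eq0.
  by move/eqP.
move=> dimp; have p_full : limg p = fullv.
  by apply/eqP; rewrite eqEdim subvf dimp /=.
apply/lfunP => x; rewrite opp_lfunE id_lfunE.
have /memv_imgP[y _ ->]: x \in limg p by rewrite p_full memvf.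
by rewrite pE fp.
Qed.

End Involution.

(** * Wedderburn decomposition *)

(* A two-sided ideal direct factor of A isomorphic to a matrix algebra: [bemb] *)
(* is the inclusion and [brep] the projection.                                 *)
Record matrix_block (K : fieldType) (A : falgType K) := MatrixBlock {
  bdeg : nat;
  brep : {linear A -> 'M[K]_bdeg};
  bemb : {linear 'M[K]_bdeg -> A};
  bdeg_gt0 : (0 < bdeg)%N;
  bembK : cancel bemb brep;
  brepM : {morph brep : a b / a * b >-> a *m b};
  bemb_repl : forall a, bemb (brep a) = bemb 1%:M * a;
  bemb_repr : forall a, bemb (brep a) = a * bemb 1%:M
}.

Definition bidem (K : fieldType) (A : falgType K) (B : matrix_block A) : A :=
  bemb B 1%:M.

Section MatrixBlock.
Variables (K : fieldType) (A : falgType K) (B : matrix_block A).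
Implicit Types (X Y : 'M[K]_(bdeg B)) (a : A).

Lemma bidem_central a : bidem B * a = a * bidem B.
Proof. by rewrite -bemb_repl bemb_repr. Qed.

Lemma brep_idem : brep B (bidem B) = 1%:M.
Proof. exact: bembK. Qed.

Lemma brep1 : brep B 1 = 1%:M.
Proof.
by rewrite -[LHS]mulmx1 -[X in _ *m X]brep_idem -brepM mul1r brep_idem.
Qed.

Lemma bidem_emb X : bidem B * bemb B X = bemb B X.
Proof. by rewrite -bemb_repl bembK. Qed.

Lemma bembM X Y : bemb B X * bemb B Y = bemb B (X *m Y).
Proof.
by rewrite -{1}(bidem_emb X) -mulrA -bemb_repl brepM !bembK.
Qed.

Lemma bidemK : bidem B * bidem B = bidem B.
Proof. exact: bidem_emb. Qed.

End MatrixBlock.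

Section Wedderburn.
Variables (K : closedFieldType) (A : falgType K).
Hypothesis ssA : semisimple_algebra A.

Definition left_ideal (U : {vspace A}) := forall a x, x \in U -> a * x \in U.

(** Decompose 1 as [e + w] along a complementary left ideal [W]. For [x] in [U], the element
    [x - x * e = x * w] lies in both [U] and [W], hence vanishes. *)
Lemma left_ideal_idem (U : {vspace A}) : left_ideal U ->
  exists2 e, e \in U & forall x, x \in U -> x * e = x.
Proof.
move=> idU.
have subl (V : {vspace regular_module A}) : left_ideal V <-> submodule V.
  split=> [idV a | sV a x Vx].
    apply/subvP => _ /memv_imgP[x Vx ->]; rewrite /= /regular_act lfunE /= lfunE.
    exact: idV.
  have /subvP/(_ (a * x)) := sV a; apply.
  have -> : a * x = act (regular_module A) a x.
    by rewrite /= /regular_act lfunE /= lfunE.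
  exact: memv_img.
have [W [/subl idW UW1 UW0]] := ssA (iffLR (subl U) idU).
have: (1 : A) \in (U + W)%VS by rewrite UW1 memvf.
case/memv_addP=> e Ue [w Ww e1]; exists e => // x Ux.
apply/esym/eqP; rewrite -subr_eq0 -memv0 -UW0 memv_cap.
have xE : x - x * e = x * w by rewrite -{1}[x]mulr1 e1 mulrDr addrC addKr.
by rewrite {2}xE idW // rpredB // idU.
Qed.

Lemma mem_limg_amulr (c x : A) : x * c \in limg (amulr c).
Proof.
by have <- : amulr c x = x * c; [rewrite lfunE | rewrite memv_img ?memvf].
Qed.

Lemma left_ideal_mulr (c : A) : left_ideal (limg (amulr c)).
Proof.
by move=> a _ /memv_imgP[x _ ->]; rewrite lfunE /= mulrA mem_limg_amulr.
Qed.

Lemma minimal_left_ideal (U : {vspace A}) : left_ideal U -> U != 0%VS ->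
  exists L, [/\ left_ideal L, L != 0%VS, (L <= U)%VS &
    forall L', left_ideal L' -> (L' <= L)%VS -> L' != 0%VS -> L' = L].
Proof.
move: {2}(\dim U) (leqnn (\dim U)) => m.
elim: m U => [|m IHm] U dimU idU U0.
  by case/negP: U0; rewrite -dimv_eq0 -leqn0.
have [minU | ] := pselect (forall L, left_ideal L -> (L <= U)%VS ->
  L != 0%VS -> L = U); first by exists U.
move=> /existsNP[L /not_implyP[idL /not_implyP[LU /not_implyP[L0 LnU]]]].
have ltL : (\dim L <= m)%N.
  rewrite -ltnS (leq_trans _ dimU) // ltn_neqAle dimvS // andbT.
  by apply/eqP => dimL; apply/LnU/eqP; rewrite eqEdim LU dimL /=.
have [L' [idL' L'0 L'L minL']] := IHm L ltL idL L0.
by exists L'; split=> //; exact: subv_trans LU.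
Qed.

(** The idempotent generating the left ideal [A x] has the form [a * x], so [x = x * a * x] for some
    [a]. *)
Lemma semiprime (x : A) : (forall a, x * a * x = 0) -> x = 0.
Proof.
move=> xAx; have [_ /memv_imgP[a _ ->] fP] := left_ideal_idem (@left_ideal_mulr x).
rewrite lfunE /= in fP; have := fP _ (mem_limg_amulr x 1).
by rewrite mul1r mulrA xAx => <-.
Qed.

(** Algebraic closure enters here: the matrix [M] of right multiplication by [a] on [L] has a
    characteristic root. *)
Lemma left_ideal_eigen (L : {vspace A}) (a : A) : L != 0%VS ->
    (forall x, x \in L -> x * a \in L) ->
  exists c, exists2 x, x \in L & x != 0 /\ x * a = c *: x.
Proof.
move=> L0 La; pose M : 'M[K]_(\dim L) := \matrix_(i, j)
  coord (vbasis L) j ((vbasis L)`_i * a).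
have vbL i : (vbasis L)`_i \in L by case: (ltnP i (\dim L)) => [ltid|leid];
  [rewrite vbasis_mem ?mem_nth ?size_tuple // | rewrite nth_default ?size_tuple ?mem0v].
have [c rootc] : exists c, root (char_poly M) c.
  by apply/closed_rootP; rewrite size_char_poly eqSS dimv_eq0.
have /eigenvalueP[v vM v0]: eigenvalue M c by rewrite eigenvalue_root_char.
exists c; exists (\sum_i v 0 i *: (vbasis L)`_i).
  by rewrite rpred_sum // => i _; rewrite rpredZ.
split.
  apply: contraNneq v0 => s0; apply/eqP/rowP => i; rewrite mxE.
  by have /freeP/(_ (v 0) s0) := basis_free (vbasisP L).
rewrite mulr_suml scaler_sumr; under eq_bigr => i _.
  rewrite -scalerAl (coord_vbasis (La _ (vbL i))) scaler_sumr.
  over.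
rewrite exchange_big; apply: eq_bigr => j _ /=.
have /rowP/(_ j) := vM; rewrite !mxE scalerA => <-.
by rewrite scaler_suml; apply: eq_bigr => i _; rewrite !mxE scalerA.
Qed.


Section Block.
Variables (L : {vspace A}) (e : A).
Hypotheses (idL : left_ideal L) (L0 : L != 0%VS).
Hypothesis minL :
  forall L', left_ideal L' -> (L' <= L)%VS -> L' != 0%VS -> L' = L.
Hypotheses (Le : e \in L) (LeK : forall x, x \in L -> x * e = x).

Let ee : e * e = e. Proof. exact: LeK. Qed.

Let e0 : e != 0.
Proof.
apply: contraNneq L0 => e0; rewrite -subv0; apply/subvP => x Lx.
by rewrite -(LeK Lx) e0 mulr0 mem0v.
Qed.

(** A form of Schur's lemma. The solutions in [L] of [y * (e * a * e) = c *: y] form a left ideal,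
    nonzero by [left_ideal_eigen]; by minimality it is all of [L], so it contains [e]. *)
Lemma minimal_corner a : exists c, e * a * e = c *: e.
Proof.
have Lmul x : x \in L -> x * (e * a * e) \in L by move=> _; do 2!apply: idL.
have [c [x Lx [x0 xa]]] := left_ideal_eigen L0 Lmul; exists c.
pose r := amulr (e * a * e - c%:A).
have rE y : r y = y * (e * a * e) - c *: y.
  by rewrite lfunE /= mulrBr -scalerAr mulr1.
have: e \in (L :&: lker r)%VS.
  rewrite (@minL (L :&: lker r)%VS) ?capvSl //.
    move=> b y; rewrite !memv_cap !memv_ker !rE => /andP[Ly /eqP ry].
    by rewrite idL //= -(mulrA b) scalerAr -mulrBr ry mulr0.
  apply: contraNneq x0 => L'0; rewrite -memv0 -L'0 memv_cap Lx memv_ker rE xa.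
  by rewrite subrr /=.
rewrite memv_cap memv_ker rE => /andP[_]; rewrite subr_eq0 => /eqP <-.
by rewrite !mulrA ee.
Qed.

Let phi : {scalar A} := coord [tuple e] ord0.

Let phie c : phi (c *: e) = c.
Proof.
rewrite linearZ /= /phi -[X in coord _ _ X]/([tuple e]`_(@ord0 0)).
by rewrite coord_free ?eqxx ?mulr1 // seq1_free.
Qed.

Let phiE a : e * a * e = phi (e * a * e) *: e.
Proof. by have [c ->] := minimal_corner a; rewrite phie. Qed.

Let d := \dim L.
Let y (j : 'I_d) : A := (vbasis L)`_j.

Let Ly j : y j \in L. Proof. by rewrite vbasis_mem ?mem_nth ?size_tuple. Qed.

(* The pairing e A * L -> e A e = K e is nondegenerate on the side of L. *)
Lemma minimal_dual_basis : exists x : 'I_d -> A,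
  (forall i, e * x i = x i) /\ forall i j, x i * y j = (i == j)%:R *: e.
Proof.
pose n := \dim {:A}; pose b (k : 'I_n) : A := (vbasis {:A})`_k.
pose N : 'M[K]_(n, d) := \matrix_(k, j) phi (e * b k * y j).
have: row_full N.
  rewrite /row_full -mxrank_tr -/(row_free N^T).
  apply: inj_row_free => v /rowP vN.
  have [z zE] : exists z, z = \sum_j v 0 j *: y j by eexists.
  have Lz : z \in L by rewrite zE rpred_sum // => j _; rewrite rpredZ.
  have ez a : e * a * z = 0.
    rewrite (coord_vbasis (memvf a)) mulr_sumr mulr_suml big1 // => k _.
    rewrite -scalerAr -scalerAl -[z](LeK Lz) mulrA -[_`_k]/(b k).
    rewrite -(mulrA e) phiE mulrA.
    have := vN k; rewrite !mxE => s0.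
    suff -> : phi (e * b k * z * e) = 0 by rewrite scale0r scaler0.
    rewrite -mulrA LeK // zE mulr_sumr linear_sum -[RHS]s0.
    by apply: eq_bigr => j _; rewrite -scalerAr linearZ !mxE.
  (* Otherwise [A z = L] by minimality, so [e = a * z] for some [a], and
     [e = e * e = e * a * z = 0]. *)
  have z0 : z = 0.
    apply/eqP/negPn/negP => z0.
    have: e \in limg (amulr z).
      rewrite (minL (@left_ideal_mulr z)) //.
        by apply/subvP => _ /memv_imgP[a _ ->]; rewrite lfunE idL.
      apply: contraNneq z0 => z0; rewrite -memv0 -z0 -[X in X \in _]mul1r.
      exact: mem_limg_amulr.
    case/memv_imgP=> a _; rewrite lfunE /= => eE; case/eqP: e0.
    by rewrite -ee {2}eE mulrA ez.
  apply/rowP => j; rewrite mxE; rewrite zE in z0.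
  by have /freeP/(_ (v 0) z0) := basis_free (vbasisP L).
case/row_fullP=> M MN; exists (fun i => \sum_k M i k *: (e * b k)); split=> [i|i j].
  by rewrite mulr_sumr; apply: eq_bigr => k _; rewrite -scalerAr mulrA ee.
have /matrixP/(_ i j) := MN; rewrite !mxE => <-.
rewrite mulr_suml scaler_suml; apply: eq_bigr => k _.
rewrite mxE -scalerAl -scalerA; congr (_ *: _).
by rewrite -[y j]LeK // mulrA -(mulrA e) phiE phie.
Qed.

(* The products y_i x_j of dual bases of L and e A are matrix units. *)
Lemma minimal_matrix_block : exists B : matrix_block A,
  exists y : 'I_(bdeg B) -> A, exists2 x : 'I_(bdeg B) -> A,
    forall i, y i \in L & bidem B = \sum_i y i * x i.
Proof.
have [x [ex xy]] := minimal_dual_basis.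
have Lspan a z : (forall j, a * y j = 0) -> z \in L -> a * z = 0.
  move=> ay Lz; rewrite (coord_vbasis Lz) mulr_sumr big1 // => j _.
  by rewrite -scalerAr ay scaler0.
(* Elements of [e A] act faithfully on [L]: [a * b * a = a * (b * e) * a], and [b * e] lies in
   [L]. *)
have exK a : e * a = a -> (forall j, a * y j = 0) -> a = 0.
  move=> ea ay; apply: semiprime => b; rewrite -{2}ea mulrA.
  by rewrite -(mulrA a) (Lspan a (b * e)) ?mul0r // idL.
(* The future identity of the block. It is a left identity on [L] and a right identity on [e A],
   which makes both [u * a] and [a * u] equal to [u * a * u]. *)
pose u := \sum_i y i * x i.
have uy z : z \in L -> u * z = z.
  move=> Lz; apply/eqP; rewrite -subr_eq0 -{2}[z]mul1r -mulrBl; apply/eqP.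
  apply: Lspan => // j; rewrite mulrBl mul1r mulr_suml (bigD1 j) //= -mulrA xy.
  rewrite eqxx scale1r LeK // big1 ?addr0 ?subrr // => i /negPf nij.
  by rewrite -mulrA xy nij scale0r mulr0.
have xu a : e * a = a -> a * u = a.
  move=> ea; apply/eqP; rewrite -subr_eq0; apply/eqP/exK => [|j].
    by rewrite mulrBr mulrA ea.
  by rewrite mulrBl -mulrA uy ?subrr.
have uau a : u * a = u * a * u.
  rewrite {1 2}/u !mulr_suml; apply: eq_bigr => i _.
  by rewrite -!mulrA (mulrA (x i)) xu ?mulrA ?ex.
have auu a : a * u = u * a * u.
  have auE : a * u = \sum_i (a * y i) * x i.
    by rewrite /u mulr_sumr; apply: eq_bigr => i _; rewrite mulrA.
  rewrite -(mulrA u) auE mulr_sumr; apply: eq_bigr => i _.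
  by rewrite mulrA uy // idL.
have xay i a j : x i * a * y j = phi (x i * a * y j) *: e.
  by rewrite -(ex i) -(LeK (Ly j)) !mulrA -2!(mulrA e) phiE phie.
pose rep a : 'M[K]_d := \matrix_(i, j) phi (x i * a * y j).
pose emb (X : 'M[K]_d) := \sum_i \sum_j X i j *: (y i * x j).
have rep_lin : linear rep.
  move=> c a b; apply/matrixP=> i j.
  by rewrite !mxE mulrDr mulrDl -scalerAr -scalerAl linearP.
have emb_lin : linear emb.
  move=> c X Y; rewrite scaler_sumr -big_split; apply: eq_bigr => i _ /=.
  rewrite scaler_sumr -big_split; apply: eq_bigr => j _ /=.
  by rewrite !mxE scalerDl scalerA.
pose Rep : {linear A -> 'M[K]_d} := HB.pack rep
  (GRing.isSemilinear.Build K A 'M[K]_d _ rep (GRing.semilinear_linear rep_lin)).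
pose Emb : {linear 'M[K]_d -> A} := HB.pack emb
  (GRing.isSemilinear.Build K 'M[K]_d A _ emb (GRing.semilinear_linear emb_lin)).
have emb1 : emb 1%:M = u.
  apply: eq_bigr => i _; rewrite (bigD1 i) //= mxE eqxx scale1r big1 ?addr0 //.
  by move=> j /negPf nij; rewrite mxE eq_sym nij scale0r.
have emb_rep a : emb (rep a) = u * a * u.
  rewrite {1}/u !mulr_suml; apply: eq_bigr => i _.
  rewrite {1}/u mulr_sumr; apply: eq_bigr => j _.
  rewrite mxE -{1}[y i]LeK // -(mulrA (y i) e) scalerAr scalerAl -xay !mulrA.
  by rewrite -(ex i) !mulrA LeK.
have d_gt0 : (0 < d)%N by rewrite lt0n dimv_eq0.
have xyxy p i j q : x p * (y i * x j) * y q = ((p == i) && (j == q))%:R *: e.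
  by rewrite mulrA xy -!scalerAl ex xy scalerA -natrM mulnb.
have embK : cancel emb rep.
  move=> X; apply/matrixP=> p q; rewrite mxE -[RHS]phie; congr (phi _).
  rewrite mulr_sumr mulr_suml (bigD1 p) //= [X in _ + X]big1 => [|i /negPf nip].
    rewrite addr0 mulr_sumr mulr_suml (bigD1 q) //= [X in _ + X]big1 => [|j /negPf njq].
      by rewrite -scalerAr -scalerAl xyxy !eqxx scale1r addr0.
    by rewrite -scalerAr -scalerAl xyxy njq andbF scale0r scaler0.
  rewrite mulr_sumr mulr_suml big1 // => j _.
  by rewrite -scalerAr -scalerAl xyxy eq_sym nip scale0r scaler0.
have repM a b : rep (a * b) = rep a *m rep b.
  apply/matrixP=> i j; rewrite !mxE.
  rewrite mulrA -(mulrA _ b) -[b * y j]uy ?idL // mulr_suml mulr_sumr linear_sum.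
  apply: eq_bigr => k _.
  rewrite !mxE; transitivity (phi (x i * a * y k * (x k * b * y j))).
    by rewrite !mulrA.
  by rewrite (xay i) (xay k) -scalerAl -scalerAr ee scalerA !phie.
exists (@MatrixBlock K A d Rep Emb d_gt0 embK repM
  (fun a => etrans (emb_rep a) (esym (etrans (congr1 (fun v => v * a) emb1) (uau a))))
  (fun a => etrans (emb_rep a) (esym (etrans (congr1 (fun v => a * v) emb1) (auu a))))).
by exists y, x.
Qed.

End Block.

(** Induction on the dimension of [A f]: a minimal left ideal inside [A f] yields a block with
    identity [u = u * f], and the central idempotent [f - u] generates a strictly smaller ideal. *)
Lemma central_idem_blocks (f : A) :
    (forall a, f * a = a * f) -> f * f = f ->
  exists r (B : 'I_r -> matrix_block A),
    (forall k l, k != l -> bidem (B k) * bidem (B l) = 0) /\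
    \sum_k bidem (B k) = f.
Proof.
move: {2}(\dim (limg (amulr f))) (leqnn (\dim (limg (amulr f)))) => m.
elim: m f => [|m IHm] f dimf cf ff.
  exists 0%N, (fun k : 'I_0 => False_rect _ (notF (ltn_ord k))).
  split=> [[]|] //; rewrite big_ord0; apply/esym/eqP; rewrite -memv0.
  by move: dimf; rewrite leqn0 dimv_eq0 -{2}[f]mul1r => /eqP <-; apply: mem_limg_amulr.
have [-> | f0] := eqVneq f 0.
  apply: IHm => [|a|]; rewrite ?mulr0 ?mul0r //.
  suff -> : limg (amulr (0 : A)) = 0%VS by rewrite dimv0.
  apply/eqP; rewrite -subv0; apply/subvP => _ /memv_imgP[a _ ->].
  by rewrite lfunE /= mulr0 mem0v.
have Af0 : limg (amulr f) != 0%VS.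
  apply: contraNneq f0 => Af0; rewrite -memv0 -Af0 -{1}[f]mul1r.
  exact: mem_limg_amulr.
have [L [idL L0 Lf minL]] := minimal_left_ideal (@left_ideal_mulr f) Af0.
have [e Le LeK] := left_ideal_idem idL.
have [B [y [x Ly uE]]] := minimal_matrix_block idL L0 minL Le LeK.
pose u := bidem B; have uC a : u * a = a * u := bidem_central B a.
have uu : u * u = u := bidemK B.
have yf i : y i * f = y i.
  have /memv_imgP[a _ ->] := subvP Lf _ (Ly i).
  by rewrite lfunE /= -mulrA ff.
have uf : u * f = u.
  rewrite /u uE mulr_suml; apply: eq_bigr => i _.
  by rewrite -mulrA -cf mulrA yf.
have u0 : u != 0.
  apply/eqP => u0; have := brep_idem B; rewrite -/u u0 linear0.
  move/matrixP/(_ (Ordinal (bdeg_gt0 B)) (Ordinal (bdeg_gt0 B))).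
  by rewrite !mxE eqxx => /esym/eqP; rewrite oner_eq0.
pose g := f - u.
have gf : g * f = g by rewrite mulrBl ff uf.
have gu : g * u = 0 by rewrite mulrBl cf uf uu subrr.
have gC a : g * a = a * g by rewrite mulrBl mulrBr cf uC.
have gg : g * g = g by rewrite {2}/g mulrBr gf gu subr0.
have [|//|//|r [Bs [orth sumB]]] := IHm g.
  rewrite -ltnS (leq_trans _ dimf) // ltn_neqAle.
  have Ag : (limg (amulr g) <= limg (amulr f))%VS.
    apply/subvP => _ /memv_imgP[a _ ->].
    by rewrite lfunE /= -gf mulrA mem_limg_amulr.
  rewrite dimvS // andbT; apply: contra u0 => /eqP dimE.
  have /eqP AgE : (limg (amulr g) == limg (amulr f))%VS by rewrite eqEdim Ag dimE /=.
  have: u \in limg (amulr g) by rewrite AgE -uf mem_limg_amulr.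
  by case/memv_imgP=> a _; rewrite lfunE /= => uag; rewrite -uu {1}uag -mulrA gu mulr0.
have Bu k : bidem (Bs k) * u = 0.
  rewrite -[bidem _]bidemK.
  have -> : bidem (Bs k) * bidem (Bs k) = bidem (Bs k) * g.
    rewrite -sumB mulr_sumr (bigD1 k) //= big1 ?addr0 // => l nlk.
    by rewrite orth // eq_sym.
  by rewrite -mulrA gu mulr0.
exists r.+1, (fun k => if unlift ord0 k is Some l then Bs l else B); split.
  move=> k l; case: unliftP => [k'|] ->; case: unliftP => [l'|] -> //.
  - by rewrite (inj_eq lift_inj); apply: orth.
  - by move=> _; rewrite -/u uC Bu.
rewrite big_ord_recl unlift_none.
under eq_bigr => k _ do rewrite liftK.
by rewrite sumB /g addrC subrK.
Qed.

Theorem matrix_blocks : exists r (B : 'I_r -> matrix_block A),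
    (forall k l, k != l -> bidem (B k) * bidem (B l) = 0) /\
    \sum_k bidem (B k) = 1.
Proof. by apply: central_idem_blocks => [a|]; rewrite ?mul1r ?mulr1. Qed.

End Wedderburn.

(** * Matrix algebras and blocks *)

Section MatrixAlgebra.
Variables (K : fieldType) (d : nat).

(** Skolem-Noether. The images [F i j] of the matrix units multiply like matrix units. With [w] a
    nonzero column of [F o o], the matrix [g] with columns [F i o *m w] intertwines [delta_mx i j]
    and [F i j]; [h] is its inverse, read off row [p]. *)
Lemma matrix_automorphism_inner (theta : {linear 'M[K]_d -> 'M[K]_d}) :
    {morph theta : X Y / X *m Y} -> theta 1%:M = 1%:M ->
  exists2 g, g \in unitmx & forall X, theta X = g *m X *m invmx g.
Proof.
move=> thM th1; case: (posnP d) => [d0 | d_gt0].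
  move: theta thM th1; rewrite d0 => theta _ _.
  exists 1%:M => [|X]; first exact: unitmx1.
  by apply/matrixP => -[].
pose o : 'I_d := Ordinal d_gt0; pose F i j := theta (delta_mx i j).
have FM i j p q : F i j *m F p q = (j == p)%:R *: F i q.
  by rewrite -thM mul_delta_mx_cond -scaler_nat linearZ.
have Fo i j : F i o *m F o j = F i j by rewrite FM eqxx scale1r.
have F0 : F o o != 0.
  apply/eqP => F0; have: theta 1%:M = 0.
    rewrite mx1_sum_delta linear_sum big1 // => i _.
    by rewrite -/(F i i) -Fo -[F i o]Fo F0 mulmx0 mul0mx.
  by rewrite th1 => /matrixP/(_ o o)/eqP; rewrite !mxE eqxx oner_eq0.
have [p [q Fpq]] := matrix0Pn _ F0.
pose w := col q (F o o).
have Fw : F o o *m w = w.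
  by rewrite /w !colE mulmxA Fo.
have [g gdef] : exists g, g = \sum_i F i o *m w *m (delta_mx 0 i : 'rV_d).
  by eexists.
have Fg i j : F i j *m g = F i o *m w *m (delta_mx 0 j : 'rV_d).
  rewrite gdef mulmx_sumr (bigD1 j) //= big1 ?addr0 => [|l /negPf nlj].
    by rewrite !mulmxA FM eqxx scale1r.
  by rewrite !mulmxA FM eq_sym nlj scale0r !mul0mx.
have gE i j : g *m delta_mx i j = F i j *m g.
  rewrite Fg gdef mulmx_suml (bigD1 i) //= big1 ?addr0 => [|l /negPf nlj].
    by rewrite -mulmxA mul_delta_mx.
  by rewrite -mulmxA mul_delta_mx_0 ?mulmx0 // nlj.
have gX X : theta X *m g = g *m X.
  rewrite [in LHS](matrix_sum_delta X) [in RHS](matrix_sum_delta X) [theta _]linear_sum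
    mulmx_sumr mulmx_suml.
  apply: eq_bigr => i _; rewrite [theta _]linear_sum mulmx_sumr mulmx_suml.
  by apply: eq_bigr => j _; rewrite linearZ /= -scalemxAl -scalemxAr gE.
pose h := \matrix_i ((w p 0)^-1 *: row p (F o i)).
have hg : h *m g = 1%:M.
  apply/row_matrixP => i; rewrite row_mul rowK -scalemxAl -row_mul Fg Fw.
  apply/rowP => j; rewrite !mxE big_ord1 !mxE eqxx /= mulrA mulVf ?mul1r //.
  by rewrite eq_sym.
have [_ gU] := mulmx1_unit hg; exists g => // X.
by rewrite -gX mulmxK.
Qed.

(* The trace of X |-> M X N. *)
Lemma sum_delta_conj (M N : 'M[K]_d) :
  \sum_i \sum_j (M *m delta_mx i j *m N) i j = \tr M * \tr N.
Proof.
rewrite /mxtrace mulr_suml; apply: eq_bigr => i _.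
rewrite mulr_sumr; apply: eq_bigr => j _.
rewrite mxE (bigD1 j) //= big1 ?addr0 => [|l nlj]; last first.
  rewrite mxE big1 ?mul0r // => m _.
  by rewrite mxE (negPf nlj) andbF mulr0.
rewrite mxE (bigD1 i) //= big1 ?addr0 => [|m nmi]; first by rewrite mxE !eqxx mulr1.
by rewrite mxE (negPf nmi) mulr0.
Qed.

Lemma commutant_scalar (M : 'M[K]_d) :
  (forall X, M *m X = X *m M) -> exists c, M = c%:M.
Proof.
move=> MC; case: (posnP d) => [d0 | d_gt0].
  by exists 0; move: M MC; rewrite d0 => M _; apply/matrixP => -[].
pose o : 'I_d := Ordinal d_gt0; exists (M o o); apply/matrixP => i j.
have /matrixP/(_ i o) := MC (delta_mx j o).
rewrite !mxE (bigD1 j) //= big1 ?addr0 => [|l nlj]; last first.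
  by rewrite mxE (negPf nlj) mulr0.
rewrite mxE !eqxx mulr1 => ->.
rewrite (bigD1 o) //= big1 ?addr0 => [|l nlj]; last first.
  by rewrite mxE (negPf nlj) andbF mul0r.
by rewrite mxE eqxx andbT mulr_natl mulrb; case: (i == j).
Qed.

End MatrixAlgebra.

Section BlockFamily.
Variables (K : fieldType) (A : falgType K) (r : nat).
Variable B : 'I_r -> matrix_block A.
Hypothesis orthB : forall k l, k != l -> bidem (B k) * bidem (B l) = 0.
Hypothesis sumB : \sum_k bidem (B k) = 1.

Lemma sum_bemb_brep a : a = \sum_k bemb (B k) (brep (B k) a).
Proof.
rewrite -{1}[a]mul1r -sumB mulr_suml; apply: eq_bigr => k _.
by rewrite bemb_repl.
Qed.

Lemma brep_inj a b : (forall k, brep (B k) a = brep (B k) b) -> a = b.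
Proof.
move=> ab; rewrite [a]sum_bemb_brep [b]sum_bemb_brep.
by apply: eq_bigr => k _; rewrite ab.
Qed.

Lemma brep_bemb_neq k l X : k != l -> brep (B k) (bemb (B l) X) = 0.
Proof.
move=> nkl; rewrite -[LHS](@bembK _ _ (B k)) bemb_repl -(@bidem_emb _ _ (B l)) mulrA.
by rewrite -/(bidem (B k)) orthB // mul0r linear0.
Qed.

Lemma lftrace_blocks (f : 'End(A)) : lftrace f =
  \sum_k \sum_i \sum_j brep (B k) (f (bemb (B k) (delta_mx i j))) i j.
Proof.
have entry_lin k i j : linear (fun a => brep (B k) a i j : K^o).
  by move=> c a b; rewrite linearP !mxE.
pose c k i j : {scalar A} := HB.pack (fun a => brep (B k) a i j)
  (GRing.isSemilinear.Build K A K _ _ (GRing.semilinear_linear (entry_lin k i j))).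
pose p k : 'End(A) := linfun (bemb (B k) \o brep (B k)).
have fE : f = \sum_k (f \o p k)%VF.
  apply/lfunP => a; rewrite sum_lfunE {1}(sum_bemb_brep a) linear_sum.
  by apply: eq_bigr => k _; rewrite comp_lfunE lfunE.
rewrite {1}fE lftrace_sum; apply: eq_bigr => k _.
rewrite (@lftrace_finrank _ _ _ _ (fun ij => c k ij.1 ij.2)
  (fun ij => f (bemb (B k) (delta_mx ij.1 ij.2)))).
  by rewrite pair_big; apply: eq_bigr => -[i j] _.
move=> a; rewrite comp_lfunE lfunE /= {1}[brep _ a]matrix_sum_delta.
rewrite !linear_sum -(pair_big xpredT xpredT
  (fun i j => brep (B k) a i j *: f (bemb (B k) (delta_mx i j)))) /=.
apply: eq_bigr => i _; rewrite !linear_sum; apply: eq_bigr => j _.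
by rewrite !linearZ.
Qed.

(** Both sides compute the trace of the identity, hence an equation in [K] rather than in [nat]. *)
Lemma sum_bdeg2 : ((\dim {:A})%:R = \sum_k (bdeg (B k) ^ 2)%:R :> K).
Proof.
rewrite -lftrace1 lftrace_blocks; apply: eq_bigr => k _.
transitivity (\sum_(i < bdeg (B k)) \sum_(j < bdeg (B k)) 1 : K).
  apply: eq_bigr => i _; apply: eq_bigr => j _.
  by rewrite lfunE /= bembK mxE !eqxx.
by under eq_bigr do rewrite sumr_const card_ord; rewrite sumr_const card_ord -mulrnA.
Qed.

End BlockFamily.

(** * Bilinear maps and tensors *)

(* Stated for a bare operation because [tensor A A] carries no ring structure. *)
Section ConvolutionInverse.
Variables (T : zmodType) (op : T -> T -> T) (e : T).
Hypotheses (opA : associative op) (op1l : left_id e op) (op1r : right_id e op).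
Hypothesis opDl : left_distributive op +%R.
Hypothesis opDr : right_distributive op +%R.

(** A left inverse [X] and a right inverse [Z] of the matrix [Y] agree, since
    [X (Y Z) = (X Y) Z]. *)
Lemma convolution_inverse_uniq (I : finType) (X Y Z : I -> I -> T) :
    (forall i j, \sum_p op (X i p) (Y p j) = if i == j then e else 0) ->
    (forall i j, \sum_p op (Y i p) (Z p j) = if i == j then e else 0) ->
  X =2 Z.
Proof.
have op0l x : op 0 x = 0 by apply: (@addrI _ (op 0 x)); rewrite -opDl !addr0.
have op0r x : op x 0 = 0 by apply: (@addrI _ (op x 0)); rewrite -opDr !addr0.
move=> XY YZ i j.
have -> : X i j = \sum_p op (X i p) (\sum_q op (Y p q) (Z q j)).
  rewrite (bigD1 j) //= YZ eqxx op1r big1 ?addr0 // => p /negPf npj.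
  by rewrite YZ npj op0r.
have -> : Z i j = \sum_q op (\sum_p op (X i p) (Y p q)) (Z q j).
  rewrite (bigD1 i) //= XY eqxx op1l big1 ?addr0 // => p npj.
  by rewrite XY eq_sym (negPf npj) op0l.
have op_sumr x (F : I -> T) : op x (\sum_q F q) = \sum_q op x (F q).
  exact: (big_morph (op x) (opDr x) (op0r x)).
have op_suml x (F : I -> T) : op (\sum_q F q) x = \sum_q op (F q) x.
  by apply: (big_morph (op^~ x)) => // y z; apply: opDl.
under eq_bigr do rewrite op_sumr; rewrite exchange_big; apply: eq_bigr => q _ /=.
by rewrite op_suml; apply: eq_bigr => p _; rewrite opA.
Qed.

End ConvolutionInverse.

Definition bvec (K : fieldType) (V : vectType K) (i : 'I_(\dim {:V})) : V :=
  (vbasis {:V})`_i.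

Section Bilinear.
Variables (K : fieldType).
Implicit Types U V W : vectType K.

Definition bilin U V W (B : U -> V -> W) :=
  (forall v, linear (B^~ v)) /\ (forall u, linear (B u)).

Lemma tlift_sum U V W (B : U -> V -> W) (I : finType) (x : I -> U) (y : I -> V) :
  bilin B -> tlift B (\sum_i pure (x i) (y i)) = \sum_i B (x i) (y i).
Proof.
move=> [Bl Br].
pose L : {linear tensor U V -> W} := HB.pack (tlift B)
  (GRing.isSemilinear.Build K _ _ _ _ (GRing.semilinear_linear (tlift_linear B))).
rewrite -[LHS]/(L _) linear_sum; apply: eq_bigr => i _.
exact: tlift_pure.
Qed.

Lemma eq_tensor_bilin U V W (B : U -> V -> W) (I J : finType) (x : I -> U)
    (y : I -> V) (x' : J -> U) (y' : J -> V) : bilin B ->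
  \sum_i pure (x i) (y i) = \sum_j pure (x' j) (y' j) ->
  \sum_i B (x i) (y i) = \sum_j B (x' j) (y' j).
Proof. by move=> Bb E; rewrite -(tlift_sum x y Bb) E tlift_sum. Qed.

Lemma pure_bilin U V : bilin (@pure K U V).
Proof. by split; [apply: pure_linearl | apply: pure_linearr]. Qed.

Lemma bilin_comp U V U' V' W (f : U -> U') (g : V -> V') (B : U' -> V' -> W) :
  bilin B -> linear f -> linear g -> bilin (fun x y => B (f x) (g y)).
Proof. by move=> [Bl Br] fl gl; split=> z a x y; rewrite ?fl ?gl ?Bl ?Br. Qed.

Lemma bilin_scale U W (phi : {scalar U}) : bilin (fun (x : U) (y : W) => phi x *: y).
Proof.
split=> z a x y; first by rewrite linearP scalerDl scalerA.
by rewrite scalerDr !scalerA mulrC.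
Qed.

Lemma bilin_flip U V W (B : U -> V -> W) : bilin B -> bilin (fun x y => B y x).
Proof. by case=> Bl Br; split. Qed.

Lemma bilin_mul (A : falgType K) : bilin (fun x y : A => x * y).
Proof.
split=> z a x y; first by rewrite mulrDl scalerAl.
by rewrite mulrDr scalerAr.
Qed.

Lemma pure_coord_inj U V (x y : 'I_(\dim {:U}) -> V) :
  \sum_i pure (bvec i) (x i) =
    \sum_i pure (bvec i) (y i) ->
  x =1 y.
Proof.
move=> E i; have := eq_tensor_bilin (bilin_scale V (coord (vbasis {:U}) i)) E.
have bas z : \sum_(j < _) coord (vbasis {:U}) i (vbasis {:U})`_j *: z j = z i :> V.
  rewrite (bigD1 i) //= big1 => [|j nji]; rewrite coord_free ?(basis_free (vbasisP _)) //.
    by rewrite eqxx scale1r addr0.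
  by rewrite (negPf nji) scale0r.
by rewrite !bas.
Qed.

End Bilinear.

Section TensorAlgebra.
Variables (K : fieldType) (A : falgType K).

Lemma tmul_bilin : bilin (@tmul K A).
Proof.
split=> z a x y; first exact: tlift_linear.
rewrite /tmul scaler_sumr -big_split; apply: eq_bigr => i _ /=.
rewrite scaler_sumr -big_split; apply: eq_bigr => j _ /=.
by rewrite tlift_linear scalerDr !scalerA mulrC.
Qed.

Lemma tmul_sum (I J : finType) (x x' : I -> A) (y y' : J -> A) :
  tmul (\sum_i pure (x i) (x' i)) (\sum_j pure (y j) (y' j)) =
  \sum_i \sum_j pure (x i * y j) (x' i * y' j).
Proof.
have [Bl Br] := tmul_bilin.
pose L t : {linear tensor A A -> tensor A A} := HB.pack (fun s => tmul s t)
  (GRing.isSemilinear.Build K _ _ _ _ (GRing.semilinear_linear (Bl t))).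
pose R s : {linear tensor A A -> tensor A A} := HB.pack (tmul s)
  (GRing.isSemilinear.Build K _ _ _ _ (GRing.semilinear_linear (Br s))).
rewrite -[LHS]/(L _ _) linear_sum; apply: eq_bigr => i _ /=.
rewrite -[LHS]/(R _ _) linear_sum; apply: eq_bigr => j _ /=.
exact: tmul_pure.
Qed.

Lemma tensor_sum (t : tensor A A) : exists x : 'I_(\dim {:A}) -> A,
  t = \sum_i pure (bvec i) (x i).
Proof.
exists (fun i => \sum_j (t : 'M_(_, _)) i j *: (vbasis {:A})`_j).
rewrite {1}[t]matrix_sum_delta; apply: eq_bigr => i _.
have [_ /(_ (bvec i)) Br] := pure_bilin A A.
pose R : {linear A -> tensor A A} := HB.pack (pure (bvec i))
  (GRing.isSemilinear.Build K _ _ _ _ (GRing.semilinear_linear Br)).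
rewrite -[RHS]/(R _) linear_sum; apply: eq_bigr => j _; rewrite linearZ; congr (_ *: _).
apply/matrixP=> k l; rewrite !mxE !coord_free ?(basis_free (vbasisP _)) //.
by rewrite -natrM mulnb (eq_sym i) (eq_sym j).
Qed.

Lemma tmulA : associative (@tmul K A).
Proof.
move=> r s t; have [x ->] := tensor_sum r; have [y ->] := tensor_sum s.
have [z ->] := tensor_sum t.
pose b := @bvec _ A; rewrite !tmul_sum.
rewrite (pair_big xpredT xpredT (fun i j => pure (b i * b j) (y i * z j))) /=.
rewrite (pair_big xpredT xpredT (fun i j => pure (b i * b j) (x i * y j))) /=.
rewrite !tmul_sum -(pair_big xpredT xpredT
  (fun i j => \sum_k pure (b i * b j * b k) (x i * y j * z k))) /=.
apply: eq_bigr => i _; rewrite pair_big; apply: eq_bigr => -[j k] _ /=.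
by rewrite !mulrA.
Qed.

Lemma tmul1l : left_id (pure 1 1) (@tmul K A).
Proof.
move=> t; have [x ->] := tensor_sum t.
have := tmul_sum (fun _ : 'I_1 => 1) (fun=> 1) (@bvec _ A) x.
by rewrite !big_ord1 => ->; apply: eq_bigr => i _; rewrite !mul1r.
Qed.

Lemma tmul1r : right_id (pure 1 1) (@tmul K A).
Proof.
move=> t; have [x ->] := tensor_sum t.
have := tmul_sum (@bvec _ A) x (fun _ : 'I_1 => 1) (fun=> 1).
rewrite big_ord1 => ->; apply: eq_bigr => i _; rewrite big_ord1.
by rewrite !mulr1.
Qed.

Lemma tmulDl : left_distributive (@tmul K A) +%R.
Proof.
move=> r s t; have [Bl _] := tmul_bilin.
by have := Bl t 1 r s; rewrite !scale1r.
Qed.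

Lemma tmulDr : right_distributive (@tmul K A) +%R.
Proof.
move=> r s t; have [_ Br] := tmul_bilin.
by have := Br r 1 s t; rewrite !scale1r.
Qed.

End TensorAlgebra.

(** * Coefficients of the comultiplication *)

Section HopfCoefficients.
Variables (K : fieldType) (H : hopfAlgType K).
Local Notation I := 'I_(\dim {:H}).
Local Notation b := (@bvec K H).
Local Notation c := (coord (vbasis {:H})).
Local Notation S := (antipode : 'End(H)).
Local Notation eps h := ((counit : 'Hom(H, K^o)) h : K).

Fact counit_is_scalar : scalar (fun h : H => eps h).
Proof. by move=> a g h; rewrite linearP. Qed.

Definition counit_scalar : {scalar H} := HB.pack (fun h : H => eps h)
  (GRing.isSemilinear.Build K H K _ _ (GRing.semilinear_linear counit_is_scalar)).

(* The axioms of [hopfAlgType] are restated because the structures on H that   *)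
(* occur in the mixin fields are not syntactically the canonical ones.         *)
Lemma coassoc (h : H) :
  tassoc (tmap comul id (comul h)) = tmap id comul (comul h)
    :> tensor H (tensor H H).
Proof. exact: comulA. Qed.

Lemma counit_l (h : H) : tlift (fun x y : H => eps x *: y) (comul h) = h.
Proof. exact: counitl. Qed.

Lemma counit_r (h : H) : tlift (fun x y : H => eps y *: x) (comul h) = h.
Proof. exact: counitr. Qed.

Lemma comul_1 : comul (1 : H) = pure (1 : H) (1 : H).
Proof. exact: comul1. Qed.

Lemma comul_M (g h : H) : comul (g * h) = tmul (comul g) (comul h).
Proof. exact: comulM. Qed.

Lemma counit_1 : eps (1 : H) = 1.
Proof. exact: counit1. Qed.

Lemma counit_M (g h : H) : eps (g * h) = eps g * eps h.
Proof. exact: counitM. Qed.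

Lemma antipode_l (h : H) : tlift (fun x y : H => S x * y) (comul h) = eps h *: (1 : H).
Proof. exact: antipodel. Qed.

Lemma antipode_r (h : H) : tlift (fun x y : H => x * S y) (comul h) = eps h *: (1 : H).
Proof. exact: antipoder. Qed.

Lemma bilin_antipode_mul : bilin (fun x y : H => S x * y).
Proof.
exact: (bilin_comp (f := S) (g := idfun) (bilin_mul H) (linearP _)
  (fun _ _ _ => erefl)).
Qed.

Lemma bilin_mul_antipode : bilin (fun x y : H => x * S y).
Proof.
exact: (bilin_comp (f := idfun) (g := S) (bilin_mul H) (fun _ _ _ => erefl)
  (linearP _)).
Qed.

Lemma bilin_pure_antipode : bilin (fun x y : H => pure (S y) (S x)).
Proof.
by apply: bilin_flip; apply: (bilin_comp (f := S) (g := S) (pure_bilin _ _)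
  (linearP _) (linearP _)).
Qed.

Lemma coord_bvec (i j : I) : c i (b j) = (j == i)%:R.
Proof. by rewrite coord_free ?(basis_free (vbasisP _)). Qed.

Lemma bvec_sum (h : H) : h = \sum_i c i h *: b i.
Proof. exact: coord_vbasis (memvf h). Qed.

(* [comul h = sum_i b_i (x) hcoef i h] *)
Definition hcoef (i : I) (h : H) : H :=
  \sum_j (comul h : 'M_(_, _)) i j *: b j.

Fact hcoef_linear i : linear (hcoef i).
Proof.
move=> a g h; rewrite /hcoef scaler_sumr -big_split; apply: eq_bigr => j _ /=.
by rewrite linearP !mxE scalerDl scalerA.
Qed.
HB.instance Definition _ i :=
  GRing.isSemilinear.Build K H H _ (hcoef i) (GRing.semilinear_linear (hcoef_linear i)).

(* [comul b_j = sum_i b_i (x) u_ij]: the matrix of the regular comodule. *)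
Definition ucoef (i j : I) : H := hcoef i (b j).
Local Notation w := hcoef.
Local Notation u := ucoef.

Lemma comulE h : comul h = \sum_i pure (b i) (w i h).
Proof.
have [_ Br] := pure_bilin H H.
rewrite {1}[comul h]matrix_sum_delta; apply: eq_bigr => i _.
pose R : {linear H -> tensor H H} := HB.pack (pure (b i))
  (GRing.isSemilinear.Build K _ _ _ _ (GRing.semilinear_linear (Br (b i)))).
rewrite -[RHS]/(R _) linear_sum; apply: eq_bigr => j _; rewrite linearZ; congr (_ *: _).
apply/matrixP=> k l; rewrite !mxE !coord_bvec.
by rewrite -natrM mulnb (eq_sym i) (eq_sym j).
Qed.

Lemma tlift_comul (W : vectType K) (B : H -> H -> W) h : bilin B ->
  tlift B (comul h) = \sum_i B (b i) (w i h).
Proof. by move=> Bb; rewrite comulE tlift_sum. Qed.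

Lemma hcoef_sum i h : w i h = \sum_j c j h *: u i j.
Proof. by rewrite {1}(bvec_sum h) linear_sum; apply: eq_bigr => j _; rewrite linearZ. Qed.

Lemma hcoefE i h : w i h = tlift (fun x y => c i x *: y) (comul h).
Proof.
rewrite tlift_comul; last exact: bilin_scale.
rewrite (bigD1 i) //= coord_bvec eqxx scale1r big1 ?addr0 // => j nji.
by rewrite coord_bvec (negPf nji) scale0r.
Qed.

Lemma counit_bvec_hcoef h : \sum_i eps (b i) *: w i h = h.
Proof. rewrite -[RHS]counit_l tlift_comul //; exact: (bilin_scale H counit_scalar).
Qed.

Lemma counit_hcoef i h : eps (w i h) = c i h.
Proof.
have := counit_r h; rewrite tlift_comul; last first.
  exact: (bilin_flip (bilin_scale H counit_scalar)).
move=> {2}<-; rewrite [RHS]linear_sum (bigD1 i) //= [c i _]linearZ /= coord_bvec.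
rewrite eqxx mulr1 big1 ?addr0 // => j nji.
by rewrite [c i _]linearZ /= coord_bvec (negPf nji) mulr0.
Qed.

Lemma counit_ucoef i j : eps (u i j) = (i == j)%:R.
Proof. by rewrite counit_hcoef coord_bvec eq_sym. Qed.

(** By the counit axiom the entries of the matrix [u] span [H]. Linear identities then need checking
    only on these entries, where [comul] is a matrix product. *)
Lemma ucoef_span (h : H) : h = \sum_i \sum_j (eps (b i) * c j h) *: u i j.
Proof.
rewrite -{1}(counit_bvec_hcoef h); apply: eq_bigr => i _.
by rewrite hcoef_sum scaler_sumr; apply: eq_bigr => j _; rewrite scalerA.
Qed.

Lemma ucoef_ext (W : vectType K) (f g : {linear H -> W}) :
  (forall i j, f (u i j) = g (u i j)) -> f =1 g.
Proof.
move=> fg h; rewrite (ucoef_span h) !linear_sum; apply: eq_bigr => i _.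
by rewrite !linear_sum; apply: eq_bigr => j _; rewrite !linearZ /= fg.
Qed.

(** Coassociativity, compared coefficient by coefficient along the basis of the first leg. *)
Lemma comul_hcoef i h : comul (w i h) = \sum_j pure (u i j) (w j h).
Proof.
have := coassoc h; rewrite /tmap.
rewrite (@tlift_comul (tensor (tensor H H) H)); last first.
  exact: (bilin_comp (f := comul) (g := idfun) (pure_bilin (tensor H H) H)
    (linearP _) (fun _ _ _ => erefl)).
rewrite (@tlift_comul (tensor H (tensor H H))); last first.
  exact: (bilin_comp (f := idfun) (g := comul) (pure_bilin H (tensor H H))
    (fun _ _ _ => erefl) (linearP _)).
rewrite /tassoc tlift_sum; last first.
  split=> [x|t] a y z /=; first exact: tlift_linear.
  rewrite /tlift scaler_sumr -big_split; apply: eq_bigr => k _ /=.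
  rewrite scaler_sumr -big_split; apply: eq_bigr => l _ /=.
  by rewrite !pure_linearr scalerDr !scalerA mulrC.
under eq_bigr => j _.
  rewrite tlift_comul; last first.
    split=> x a y z; first by rewrite pure_linearl.
    by rewrite pure_linearl pure_linearr.
  over.
rewrite exchange_big /= => E; apply/esym; move: i; apply: pure_coord_inj.
rewrite -E; apply: eq_bigr => i _.
have [_ Br] := pure_bilin H (tensor H H).
pose R : {linear tensor H H -> tensor H (tensor H H)} := HB.pack (pure (b i))
  (GRing.isSemilinear.Build K _ _ _ _ (GRing.semilinear_linear (Br (b i)))).
by rewrite -[LHS]/(R _) linear_sum.
Qed.

Lemma comul_ucoef i j : comul (u i j) = \sum_k pure (u i k) (u k j).
Proof. exact: comul_hcoef. Qed.

Lemma antipode_hcoef_l i h : \sum_j S (u i j) * w j h = c i h *: 1.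
Proof.
have := antipode_l (w i h); rewrite comul_hcoef tlift_sum ?counit_hcoef //.
exact: bilin_antipode_mul.
Qed.

Lemma antipode_hcoef_r i h : \sum_j u i j * S (w j h) = c i h *: 1.
Proof.
have := antipode_r (w i h); rewrite comul_hcoef tlift_sum ?counit_hcoef //.
exact: bilin_mul_antipode.
Qed.

Lemma antipode_ucoef_l i j : \sum_k S (u i k) * u k j = (i == j)%:R.
Proof. by rewrite antipode_hcoef_l coord_bvec eq_sym scaler_nat. Qed.

Lemma antipode_ucoef_r i j : \sum_k u i k * S (u k j) = (i == j)%:R.
Proof. by rewrite antipode_hcoef_r coord_bvec eq_sym scaler_nat. Qed.

Lemma comulM_sum (J L : finType) (x x' : J -> H) (y y' : L -> H) g h :
    comul g = \sum_i pure (x i) (x' i) -> comul h = \sum_j pure (y j) (y' j) ->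
  comul (g * h) = \sum_i \sum_j pure (x i * y j) (x' i * y' j).
Proof. by move=> gE hE; rewrite comul_M gE hE tmul_sum. Qed.

(** On entries of [u], both sides are inverse to the same matrix [Y], the Kronecker square of [u]
    indexed by pairs: [X] on the left, by the antipode axiom for products, and [Z] on the right. *)
Lemma antipodeM (g h : H) : S (g * h) = S h * S g.
Proof.
suff uM i j k l : S (u i j * u k l) = S (u k l) * S (u i j).
  have uhM i j : S (u i j * h) = S h * S (u i j).
    have E : (S \o amull (u i j))%VF =1 (amulr (S (u i j)) \o S)%VF.
      by apply: ucoef_ext => k l; rewrite /= !comp_lfunE !lfunE /= uM.
    by have := E h; rewrite !comp_lfunE !lfunE.
  have E : (S \o amulr h)%VF =1 (amull (S h) \o S)%VF.
    by apply: ucoef_ext => k l; rewrite /= !comp_lfunE !lfunE /= uhM.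
  by have := E g; rewrite !comp_lfunE !lfunE.
pose X (p q : I * I) := S (u p.1 q.1 * u p.2 q.2).
pose Y (p q : I * I) := u p.1 q.1 * u p.2 q.2.
pose Z (p q : I * I) := S (u p.2 q.2) * S (u p.1 q.1).
have := @convolution_inverse_uniq H _ 1 (@mulrA H) (@mul1r H) (@mulr1 H)
  (@mulrDl H) (@mulrDr H) _ X Y Z.
move=> /(_ _ _ (i, k) (j, l)); apply=> -[{}i {}k] [{}j {}l] /=.
  have := antipode_l (u i j * u k l).
  rewrite (comulM_sum (comul_ucoef i j) (comul_ucoef k l)) pair_big /=.
  rewrite tlift_sum; last first.
    exact: bilin_antipode_mul.
  move=> ->; rewrite counit_M !counit_ucoef xpair_eqE -natrM mulnb scaler_nat.
  by case: (_ && _).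
rewrite -(pair_big xpredT xpredT (fun p q => u i p * u k q * (S (u q l) * S (u p j)))) /=.
transitivity (\sum_p (k == l)%:R *: (u i p * S (u p j))).
  apply: eq_bigr => p _.
  under eq_bigr do rewrite mulrA -(mulrA (u i p)).
  rewrite -mulr_suml -mulr_sumr antipode_ucoef_r.
  by rewrite mulr_natr scaler_nat mulrnAl.
rewrite -scaler_sumr antipode_ucoef_r xpair_eqE scaler_nat.
by case: (i == j); case: (k == l).
Qed.

Lemma antipode1 : S 1 = 1.
Proof.
have := antipode_l (1 : H); rewrite comul_1 counit_1 scale1r tlift_pure ?mulr1 //.
  by move=> v a x y; rewrite linearP mulrDl scalerAl.
by move=> v a x y; rewrite mulrDr scalerAr.
Qed.

Lemma counit_antipode h : eps (S h) = eps h.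
Proof.
pose f : {linear H -> K^o} := (counit : 'Hom(H, K^o)) \o S.
apply: (@ucoef_ext _ f (counit : 'Hom(H, K^o))) => i j /=; rewrite /f /=.
have := congr1 (fun x => eps x) (antipode_ucoef_l i j); rewrite linear_sum /=.
rewrite (eq_bigr (fun k => eps (S (u i k)) * (k == j)%:R)); last first.
  by move=> k _; rewrite counit_M counit_ucoef.
rewrite (bigD1 j) //= eqxx mulr1 big1 ?addr0 => [->|k /negPf ->]; last by rewrite mulr0.
by rewrite counit_ucoef; case: (i == j); rewrite ?linear0 //; exact: counit_1.
Qed.

(** The same uniqueness argument with coefficients in [H (x) H]: on entries of [u], both sides
    invert the matrix [comul (u i j)]. *)
Lemma comul_antipode h : comul (S h) = \sum_i pure (S (w i h)) (S (b i)).
Proof.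
have Bb := bilin_pure_antipode.
pose f : {linear H -> tensor H H} := comul \o S.
pose L : {linear tensor H H -> tensor H H} :=
  HB.pack (tlift (fun x y : H => pure (S y) (S x)))
  (GRing.isSemilinear.Build K _ _ _ _ (GRing.semilinear_linear (tlift_linear _))).
rewrite -(tlift_comul h Bb) -[LHS]/(f h) -[RHS]/((L \o comul) h).
apply: ucoef_ext => i j /=; rewrite /f /= comul_ucoef tlift_sum //.
pose X i j := comul (S (u i j)) : tensor H H.
pose Y i j := comul (u i j) : tensor H H.
pose Z i j := \sum_k pure (S (u k j)) (S (u i k)).
apply: (@convolution_inverse_uniq _ _ (pure 1 1) (@tmulA K H) (@tmul1l K H)
  (@tmul1r K H) (@tmulDl K H) (@tmulDr K H) _ X Y Z) => {}i {}j.
  under eq_bigr do rewrite -comul_M.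
  rewrite -linear_sum /= antipode_ucoef_l.
  by case: (i == j); rewrite ?comul_1 ?linear0.
rewrite /Y /Z; under eq_bigr do rewrite comul_ucoef tmul_sum.
rewrite exchange_big /=.
have [Bl Br] := pure_bilin H H.
transitivity (\sum_k pure (u i k * S (u k j)) (1 : H)).
  apply: eq_bigr => k _; rewrite exchange_big /=.
  pose R l : {linear H -> tensor H H} := HB.pack (pure (u i k * S (u l j)))
    (GRing.isSemilinear.Build K _ _ _ _ (GRing.semilinear_linear (Br _))).
  transitivity (\sum_l R l (\sum_p u k p * S (u p l))).
    by apply: eq_bigr => l _; rewrite [RHS]linear_sum.
  rewrite (bigD1 k) //= antipode_ucoef_r eqxx big1 ?addr0 // => l /negPf nlk.
  by rewrite antipode_ucoef_r eq_sym nlk -[LHS]/(R l 0) linear0.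
pose R : {linear H -> tensor H H} := HB.pack (fun x => pure x (1 : H))
    (GRing.isSemilinear.Build K _ _ _ _ (GRing.semilinear_linear (Bl 1))).
transitivity (R (\sum_k u i k * S (u k j))); first by rewrite [RHS]linear_sum.
by rewrite antipode_ucoef_r; case: (i == j) => //; rewrite linear0.
Qed.

Lemma comul_antipode2 h : comul (S (S h)) = \sum_i pure (S (S (b i))) (S (S (w i h))).
Proof.
have Bb := bilin_pure_antipode.
by rewrite comul_antipode -(tlift_comul _ Bb) comul_antipode tlift_sum.
Qed.

End HopfCoefficients.

(** * Integrals *)

Section BilinSum.
Variables (K : fieldType) (U V W : vectType K) (B : U -> V -> W).
Hypothesis Bb : bilin B.

Lemma bilinZl a x y : B (a *: x) y = a *: B x y.
Proof.
have [Bl _] := Bb; have B0 : B 0 y = 0.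
  by have := Bl y (-1) 0 0; rewrite scaler0 addr0 scaleN1r addNr.
by have := Bl y a x 0; rewrite B0 !addr0.
Qed.

Lemma bilinZr a x y : B x (a *: y) = a *: B x y.
Proof.
have [_ Br] := Bb; have B0 : B x 0 = 0.
  by have := Br x (-1) 0 0; rewrite scaler0 addr0 scaleN1r addNr.
by have := Br x a y 0; rewrite B0 !addr0.
Qed.

Lemma bilin_suml (I : finType) (f : I -> U) y :
  B (\sum_i f i) y = \sum_i B (f i) y.
Proof.
have [Bl _] := Bb; apply: (big_morph (B^~ y)) => [x z|].
  by have := Bl y 1 x z; rewrite !scale1r.
by rewrite -(scale0r 0) bilinZl scale0r.
Qed.

Lemma bilin_sumr (I : finType) (f : I -> V) x :
  B x (\sum_i f i) = \sum_i B x (f i).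
Proof.
have [_ Br] := Bb; apply: (big_morph (B x)) => [y z|].
  by have := Br x 1 y z; rewrite !scale1r.
by rewrite -(scale0r 0) bilinZr scale0r.
Qed.

End BilinSum.

Section Integral.
Variables (K : fieldType) (H : hopfAlgType K).
Local Notation I := 'I_(\dim {:H}).
Local Notation b := (@bvec K H).
Local Notation c := (coord (vbasis {:H})).
Local Notation S := (antipode : 'End(H)).
Local Notation eps h := ((counit : 'Hom(H, K^o)) h : K).
Local Notation w := (@hcoef K H).
Local Notation u := (@ucoef K H).

Section Slide.
Variable Lam : H.
Hypothesis intLam : normalized_integral Lam.

Lemma integral_mulr h : Lam * h = eps h *: Lam.
Proof. by case: intLam => /(_ h)[_ ->]. Qed.

Lemma integral_mull h : h * Lam = eps h *: Lam.
Proof. by case: intLam => /(_ h)[-> _]. Qed.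

Lemma counit_integral : eps Lam = 1.
Proof. by case: intLam. Qed.

(* Lam_1 h (x) Lam_2 = Lam_1 (x) Lam_2 S(h) *)
Lemma integral_slide (W : vectType K) (B : H -> H -> W) h : bilin B ->
  \sum_i B (b i * h) (w i Lam) = \sum_i B (b i) (w i Lam * S h).
Proof.
move=> Bb.
(* Apply [comul] to [Lam * b k = eps (b k) *: Lam] and multiply the second leg by [S (w k h)].
   Summed over [k], one side collapses by the counit axiom and the other by the antipode axiom. *)
have E k : \sum_i B (b i) (eps (b k) *: (w i Lam * S (w k h))) =
    \sum_i \sum_m B (b i * b m) (w i Lam * (u m k * S (w k h))).
  pose F x y := B x (y * S (w k h)).
  have Fb : bilin F.
    apply: (bilin_comp (f := id) (g := fun y => y * S (w k h)) Bb) => // a x y.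
    by rewrite mulrDl scalerAl.
  have := tlift_linear F (eps (b k)) (comul Lam) 0.
  have -> : eps (b k) *: comul Lam = comul (Lam * b k).
    by rewrite integral_mulr [RHS]linearZ.
  rewrite [X in tlift _ X]addr0 (comulM_sum (comulE Lam) (comulE (b k))).
  have -> : tlift F 0 = 0.
    by have := tlift_linear F (-1) 0 0; rewrite scaler0 addr0 scaleN1r addNr.
  rewrite addr0 pair_big tlift_sum // tlift_comul // scaler_sumr => E.
  rewrite (eq_bigr (fun i => eps (b k) *: F (b i) (w i Lam))); last first.
    by move=> i _; rewrite bilinZr.
  by rewrite -E pair_big; apply: eq_bigr => p _; rewrite /F -mulrA.
have {}E : \sum_k \sum_i B (b i) (eps (b k) *: (w i Lam * S (w k h))) =
    \sum_k \sum_i \sum_m B (b i * b m) (w i Lam * (u m k * S (w k h))).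
  by apply: eq_bigr => k _; apply: E.
move: E; rewrite exchange_big [RHS]exchange_big /= => E.
transitivity (\sum_i \sum_k \sum_m B (b i * b m) (w i Lam * (u m k * S (w k h)))).
  apply: eq_bigr => i _; rewrite exchange_big {1}(bvec_sum h) mulr_sumr bilin_suml //=.
  apply: eq_bigr => m _; rewrite -scalerAr bilinZl // -bilin_sumr // -mulr_sumr.
  by rewrite antipode_hcoef_r -scalerAr mulr1 bilinZr.
rewrite -E; apply: eq_bigr => i _; rewrite -bilin_sumr //; congr (B _ _).
rewrite -{2}(counit_bvec_hcoef h) [S _]linear_sum mulr_sumr.
by apply: eq_bigr => k _; rewrite scalerAr [RHS]/= [S (_ *: _)]linearZ.
Qed.

(* z = z Lam_1 S(Lam_2) = Lam_1 z S(Lam_2) = Lam_1 S(Lam_2 S(z)). *)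
Lemma integral_center z : (forall h, z * h = h * z) ->
  z = \sum_i b i * S (S z) * S (w i Lam).
Proof.
move=> zC; have Bb := bilin_mul_antipode H.
have := integral_slide z Bb.
under eq_bigr do rewrite -zC -mulrA; rewrite -mulr_sumr -(tlift_comul _ Bb) antipode_r.
rewrite counit_integral scale1r mulr1 => {1}->; apply: eq_bigr => i _.
by rewrite antipodeM mulrA.
Qed.

End Slide.

Section Blocks.
Variables (r : nat) (B : 'I_r -> matrix_block H).
Hypothesis sumB : \sum_k bidem (B k) = 1.

(** The block idempotents sum to 1, so [eps] is nonzero on one of them. A nonzero multiplicative
    functional on matrices forces size 1: all [f i i] are equal, yet [f i i * f j j = 0] for
    distinct [i] and [j]. *)
Lemma trivial_block : exists k0, [/\ normalized_integral (bidem (B k0)),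
  bdeg (B k0) = 1%N & forall h, \tr (brep (B k0) h) = eps h].
Proof.
have [k ek0] : exists k, eps (bidem (B k)) != 0.
  apply/existsP; apply: contraTT (oner_neq0 K) => /existsPn e0; rewrite negbK.
  rewrite -(counit_1 H) -sumB [counit _]linear_sum big1 // => k _.
  by apply/eqP; have := e0 k; rewrite negbK.
pose f i j := eps (bemb (B k) (delta_mx i j)).
have fM i j p q : f i j * f p q = f i q *+ (j == p).
  rewrite -counit_M bembM mul_delta_mx_cond; case: (j == p) => //.
  by rewrite mulr0n !linear0.
have eE : eps (bidem (B k)) = \sum_i f i i.
  by rewrite /bidem mx1_sum_delta !linear_sum.
have uniq_i (i j : 'I_(bdeg (B k))) : i = j.
  apply/eqP/negPn/negP => /negPf nij; case/eqP: ek0; rewrite eE.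
  have fii p q : f p p = f q q.
    have fpq i' j' : f i' j' * f j' i' = f i' i' by rewrite fM eqxx.
    by rewrite -(fpq p q) mulrC fpq.
  have : f i i * f i i = 0 by rewrite {2}(fii i j) fM nij.
  move/eqP; rewrite mulf_eq0 orbb => /eqP fi0.
  by rewrite big1 // => p _; rewrite (fii p i).
have deg1 : bdeg (B k) = 1%N.
  apply/eqP; rewrite eqn_leq (bdeg_gt0 (B k)) andbT leqNgt; apply/negP => d2.
  by have := uniq_i (Ordinal (bdeg_gt0 (B k))) (Ordinal d2).
have repE h : brep (B k) h = (\tr (brep (B k) h))%:M.
  apply/matrixP => i j; rewrite mxE (uniq_i i j) eqxx /mxtrace (bigD1 j) //=.
  by rewrite big1 ?addr0 // => p; rewrite (uniq_i p j) eqxx.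
have he h : h * bidem (B k) = \tr (brep (B k) h) *: bidem (B k).
  by rewrite -bemb_repr {1}repE -scalemx1 linearZ.
have trE h : \tr (brep (B k) h) = eps h.
  have := congr1 (fun x => eps x) (he h); rewrite counit_M linearZ /=.
  by move/(mulIf ek0) => ->.
exists k; split=> //; split=> [h|].
  by rewrite bidem_central he trE.
have := congr1 (fun x => eps x) (bidemK (B k)); rewrite counit_M.
by rewrite -[RHS]mul1r => /(mulIf ek0).
Qed.

(* The kernel of S is an ideal, so it would contain a block idempotent e, and   *)
(* [integral_center] gives e = Lam_1 S^2(e) S(Lam_2) = 0.                       *)
Lemma antipode_ker0 : lker S == 0%VS.
Proof.
have [k0 [intLam _ _]] := trivial_block.
rewrite -subv0; apply/subvP => a; rewrite memv_ker memv0 => /eqP Sa.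
apply/eqP; apply: (brep_inj sumB) => k; rewrite linear0.
apply/eqP/negPn/negP => /matrix0Pn[p [q apq]].
have Sek : S (bidem (B k)) = 0.
  rewrite /bidem mx1_sum_delta !linear_sum big1 // => i _ /=.
  suff -> : bemb (B k) (delta_mx i i) = (brep (B k) a p q)^-1 *:
      (bemb (B k) (delta_mx i p) * (a * bemb (B k) (delta_mx q i))).
    by rewrite [S _]linearZ /= antipodeM antipodeM Sa mulr0 mul0r scaler0.
  rewrite -(bidem_emb (delta_mx q i)) (mulrA a) -[a * bidem _]bemb_repr !bembM mulmxA.
  rewrite -linearZ; congr (bemb _ _); apply/matrixP => x y; rewrite !mxE.
  rewrite (bigD1 q) //= big1 ?addr0 => [|j njq]; last first.
    by rewrite [delta_mx q i _ _]mxE (negPf njq) mulr0.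
  rewrite mxE (bigD1 p) //= big1 ?addr0 => [|j njp]; last first.
    by rewrite mxE (negPf njp) andbF mul0r.
  rewrite !mxE !eqxx andbT /=.
  by case: (x == i); case: (y == i); rewrite ?mul0r ?mulr0 ?mul1r ?mulr1 ?mulVf.
have := integral_center intLam (bidem_central (B k)).
rewrite Sek; under eq_bigr do rewrite linear0 mulr0 mul0r.
rewrite big1 // => e0; have := brep_idem (B k); rewrite e0 linear0.
move/matrixP/(_ (Ordinal (bdeg_gt0 (B k))) (Ordinal (bdeg_gt0 (B k))))/esym/eqP.
by rewrite !mxE eqxx oner_eq0.
Qed.

End Blocks.
End Integral.

(** * The dual integral and its modulus *)

Section DualIntegral.
Variables (K : fieldType) (H : hopfAlgType K).
Local Notation I := 'I_(\dim {:H}).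
Local Notation b := (@bvec K H).
Local Notation c := (coord (vbasis {:H})).
Local Notation S := (antipode : 'End(H)).
Local Notation eps h := ((counit : 'Hom(H, K^o)) h : K).
Local Notation w := (@hcoef K H).
Local Notation u := (@ucoef K H).

Variable Lam : H.
Hypothesis intLam : normalized_integral Lam.
Hypothesis kerS : lker S == 0%VS.

Definition antipode_inv : 'End(H) := (S^-1)%VF.
Local Notation T := antipode_inv.

Lemma antipodeK x : T (S x) = x. Proof. exact: lker0_lfunK. Qed.
Lemma antipode_invK x : S (T x) = x. Proof. exact: lker0_lfunVK. Qed.

Lemma antipode_inj x y : S x = S y -> x = y.
Proof. by move=> Sxy; rewrite -(antipodeK x) Sxy antipodeK. Qed.

Lemma antipode_invM x y : T (x * y) = T y * T x.
Proof. by apply: antipode_inj; rewrite antipodeM !antipode_invK. Qed.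

Lemma antipode_inv1 : T 1 = 1.
Proof. by apply: antipode_inj; rewrite antipode_invK antipode1. Qed.

Lemma counit_antipode_inv x : eps (T x) = eps x.
Proof. by rewrite -(counit_antipode (T x)) antipode_invK. Qed.

Lemma comul_antipode_inv2 h :
  comul (T (T h)) = \sum_i pure (T (T (b i))) (T (T (w i h))).
Proof.
have Bb : bilin (fun x y : H => pure (T (T x)) (T (T y))).
  by apply: (bilin_comp (f := fun x => T (T x)) (g := fun x => T (T x))
    (pure_bilin H H)) => a x y; rewrite !linearP.
rewrite -[in RHS](antipode_invK h) -[in RHS](antipode_invK (T h)).
rewrite -(tlift_comul _ Bb) comul_antipode2 tlift_sum //.
by under eq_bigr do rewrite !antipodeK; rewrite -comulE.
Qed.

Lemma hcoef_antipode_inv2 i h :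
  w i (T (T h)) = \sum_j c i (T (T (b j))) *: T (T (w j h)).
Proof.
have Bb := bilin_scale H (c i : {scalar H}).
by rewrite hcoefE comul_antipode_inv2 tlift_sum.
Qed.

(** As [S (S z)] is central, it can be pulled out of the sum in [integral_center], leaving
    [Lam_1 S(Lam_2) = 1]. *)
Lemma antipode2_center z : (forall h, z * h = h * z) -> S (S z) = z.
Proof.
have Scent y : (forall h, y * h = h * y) -> forall h, S y * h = h * S y.
  by move=> yC h; rewrite -(antipode_invK h) -!antipodeM yC.
move=> zC; rewrite [RHS](integral_center intLam zC).
under eq_bigr do rewrite -(Scent _ (Scent _ zC)) -mulrA.
have Bb := bilin_mul_antipode H.
rewrite -mulr_sumr -(tlift_comul _ Bb) antipode_r.
by rewrite (counit_integral intLam) scale1r mulr1.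
Qed.

(** An integral of the dual Hopf algebra, given by a trace formula. When [S] is an involution it is
    the character of the regular module. *)
Definition dual_integral_fun (h : H) : K := lftrace (amull h \o (T \o T))%VF.

Fact dual_integral_linear : scalar dual_integral_fun.
Proof.
move=> a x y; rewrite /dual_integral_fun -lftraceZ -lftraceD; congr lftrace.
by rewrite linearP comp_lfunDl comp_lfunZl.
Qed.

Definition lam : {scalar H} := HB.pack dual_integral_fun
  (GRing.isSemilinear.Build K H K _ _ (GRing.semilinear_linear dual_integral_linear)).

Lemma lamZ a h : lam (a *: h) = a * lam h.
Proof. exact: linearZ. Qed.

Lemma lamB g h : lam (g - h) = lam g - lam h.
Proof. exact: linearB. Qed.

Lemma lamE h : lam h = \sum_i \sum_j c i (h * b j) * c j (T (T (b i))).
Proof.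
apply: eq_bigr => i _; rewrite !comp_lfunE lfunE /=.
rewrite {1}(bvec_sum (T (T (b i)))) mulr_sumr linear_sum; apply: eq_bigr => j _.
by rewrite -scalerAr linearZ /= mulrC.
Qed.

(* With [u] the matrix of the regular comodule and [h] that of left             *)
(* multiplication by h, this is [h_1] h_2 = u [h] S(u).                         *)
Lemma lmul_comul h x y : \sum_i c x (b i * b y) *: w i h =
  \sum_k \sum_l c l (h * b k) *: (u x l * S (u k y)).
Proof.
pose dl z := \sum_i c x (b i * b z) *: w i h.
have dlu k : \sum_z dl z * u z k = \sum_l c l (h * b k) *: u x l.
  transitivity (w x (h * b k)); last by rewrite hcoef_sum.
  rewrite hcoefE (comulM_sum (comulE h) (comulE (b k))) pair_big tlift_sum;
    last exact: bilin_scale.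
  rewrite -(pair_big xpredT xpredT
    (fun i m => c x (b i * b m) *: (w i h * w m (b k)))) /=.
  rewrite exchange_big; apply: eq_bigr => z _ /=.
  by rewrite mulr_suml; apply: eq_bigr => i _; rewrite -scalerAl.
transitivity (\sum_z dl z * \sum_k u z k * S (u k y)).
  rewrite [RHS](bigD1 y) //= antipode_ucoef_r eqxx mulr1.
  rewrite [X in _ = _ + X]big1 ?addr0 // => z /negPf nzy.
  by rewrite antipode_ucoef_r nzy mulr0.
under eq_bigr do rewrite mulr_sumr; rewrite exchange_big; apply: eq_bigr => k _ /=.
under eq_bigr do rewrite mulrA; rewrite -mulr_suml dlu mulr_suml.
by apply: eq_bigr => l _; rewrite -scalerAl.
Qed.

(* lam(h_1) h_2 is the trace of [h_1] h_2 t = u [h] S(u) t = u [h] t T(u), with *)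
(* t the matrix of T^2, hence equals lam(h).                                    *)
Lemma lam_invariant h : \sum_i lam (b i) *: w i h = lam h *: 1.
Proof.
pose lm x i j := c i (x * b j); pose t i j := c i (T (T (b j))).
pose dl x y := \sum_i lm (b i) x y *: w i h.
have ut m k : \sum_l t l k *: u m l = \sum_i t m i *: T (T (u i k)).
  by rewrite -hcoef_antipode_inv2 -hcoef_sum.
transitivity (\sum_x \sum_y t y x *: dl x y).
  under eq_bigr do rewrite lamE scaler_suml.
  rewrite exchange_big; apply: eq_bigr => x _ /=.
  under eq_bigr do rewrite scaler_suml.
  rewrite exchange_big; apply: eq_bigr => y _ /=.
  rewrite scaler_sumr; apply: eq_bigr => i _.
  by rewrite scalerA mulrC.
have dlE x y : dl x y = \sum_k \sum_l lm h l k *: (u x l * S (u k y)).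
  exact: lmul_comul.
transitivity (\sum_x \sum_k \sum_l lm h l k *: (u x l * \sum_m t k m *: T (u m x))).
  apply: eq_bigr => x _; under eq_bigr do rewrite dlE scaler_sumr.
  rewrite exchange_big; apply: eq_bigr => k _ /=.
  under eq_bigr do rewrite scaler_sumr.
  rewrite exchange_big; apply: eq_bigr => l _ /=.
  have -> : \sum_m t k m *: T (u m x) = \sum_y t y x *: S (u k y).
    transitivity (S (\sum_m t k m *: T (T (u m x)))).
      rewrite [RHS]linear_sum; apply: eq_bigr => m _.
      by rewrite [RHS]linearZ /= antipode_invK.
    rewrite -ut [LHS]linear_sum; apply: eq_bigr => y _.
    by rewrite [LHS]linearZ.
  rewrite mulr_sumr scaler_sumr; apply: eq_bigr => y _.
  by rewrite -scalerAr !scalerA mulrC.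
rewrite exchange_big lamE [X in _ = X *: _]exchange_big scaler_suml.
apply: eq_bigr => k _ /=.
rewrite exchange_big scaler_suml; apply: eq_bigr => l _ /=.
rewrite -scaler_sumr -scalerA; congr (_ *: _).
under eq_bigr do rewrite mulr_sumr.
rewrite exchange_big (bigD1 l) //= [X in _ + X]big1 ?addr0; last first.
  move=> m /negPf nml; under eq_bigr do rewrite -scalerAr; rewrite -scaler_sumr.
  have -> : \sum_x u x l * T (u m x) = T (\sum_x u m x * S (u x l)).
    by rewrite [RHS]linear_sum; apply: eq_bigr => x _ /=; rewrite antipode_invM antipodeK.
  by rewrite antipode_ucoef_r nml linear0 scaler0.
under eq_bigr do rewrite -scalerAr; rewrite -scaler_sumr.
have -> : \sum_x u x l * T (u l x) = T (\sum_x u l x * S (u x l)).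
  by rewrite [RHS]linear_sum; apply: eq_bigr => x _ /=; rewrite antipode_invM antipodeK.
by rewrite antipode_ucoef_r eqxx antipode_inv1.
Qed.

(** The operator whose trace is taken has rank one: it is [x |-> eps(x) Lam], as [T] preserves the
    counit. *)
Lemma lam_Lam : lam Lam = 1.
Proof.
rewrite -[LHS]/(lftrace _).
rewrite (@lftrace_finrank _ _ 'I_1 _ (fun=> counit_scalar H) (fun=> Lam)).
  by rewrite big_ord1; apply: (counit_integral intLam).
move=> x; rewrite big_ord1 !comp_lfunE lfunE /= (integral_mulr intLam).
by rewrite -(counit_antipode_inv x) -(counit_antipode_inv (T x)).
Qed.

(** By [integral_slide] the sum is [lam(Lam_1) Lam_2 S(h)], and invariance of [lam] finishes. This
    recovers [S] from the two integrals. *)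
Lemma lam_slide h : \sum_i lam (b i * h) *: w i Lam = S h.
Proof.
rewrite (integral_slide intLam h (bilin_scale H lam)) -[RHS]mul1r -(scale1r 1).
rewrite -lam_Lam -lam_invariant mulr_suml; apply: eq_bigr => i _.
by rewrite scalerAl.
Qed.

Lemma lam_nondegenerate h : (forall x, lam (x * h) = 0) -> h = 0.
Proof.
move=> lam0; apply: antipode_inj; rewrite -lam_slide linear0 big1 // => i _.
by rewrite lam0 scale0r.
Qed.

(** [T^2] is the Nakayama automorphism of [lam]: cyclicity of the trace carries left multiplication
    by [x] across [T^2]. *)
Lemma lamM x y : lam (x * y) = lam (y * T (T x)).
Proof.
rewrite -[LHS]/(lftrace _) -[RHS]/(lftrace _).
have -> : (amull (x * y) \o (T \o T) = amull x \o (amull y \o (T \o T)))%VF.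
  by apply/lfunP => z; rewrite !comp_lfunE !lfunE /= mulrA.
rewrite lftraceC; congr lftrace; apply/lfunP => z.
by rewrite !comp_lfunE !lfunE /= -mulrA -!antipode_invM.
Qed.

Lemma lam_antipode2 x : lam (S (S x)) = lam x.
Proof.
rewrite -[LHS]/(lftrace _) -[RHS]/(lftrace _).
have -> : (amull (S (S x)) \o (T \o T) =
    (S \o S) \o ((amull x \o (T \o T)) \o (T \o T)))%VF.
  by apply/lfunP => z; rewrite !comp_lfunE !lfunE /= !antipodeM !antipode_invK.
rewrite lftraceC; congr lftrace; apply/lfunP => z.
by rewrite !comp_lfunE !lfunE /= !antipodeK.
Qed.

(** Nondegeneracy makes the Gram matrix [M] of [lam] invertible. *)
Lemma lam_represent (phi : {scalar H}) : exists g, forall x, phi x = lam (x * g).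
Proof.
pose M : 'M[K]_(\dim {:H}) := \matrix_(i, j) lam (b j * b i).
have Mfree : row_free M.
  apply: inj_row_free => v vM; pose g := \sum_i v 0 i *: b i.
  have g0 : g = 0.
    apply: lam_nondegenerate => x.
    rewrite (bvec_sum x) mulr_suml linear_sum big1 // => j _.
    rewrite -scalerAl lamZ.
    suff -> : lam (b j * g) = (v *m M) 0 j by rewrite vM mxE mulr0.
    rewrite [b j * g]mulr_sumr [LHS]linear_sum mxE; apply: eq_bigr => i _.
    by rewrite -scalerAr lamZ [M i j]mxE.
  apply/rowP => i; rewrite mxE.
  by have /freeP/(_ (v 0) g0) := basis_free (vbasisP {:H}).
have /row_fullP[N NM] : row_full M by [].
pose v := (\row_j phi (b j)) *m N.
have vM : v *m M = \row_j phi (b j) by rewrite -mulmxA NM mulmx1.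
exists (\sum_i v 0 i *: b i) => x.
rewrite {1}(bvec_sum x) [in RHS](bvec_sum x) mulr_suml [LHS]linear_sum [RHS]linear_sum.
apply: eq_bigr => j _; rewrite -scalerAl [LHS]linearZ lamZ; congr (_ * _).
have /rowP/(_ j) := vM; rewrite [in RHS]mxE => <-.
rewrite [b j * _]mulr_sumr [RHS]linear_sum mxE; apply: eq_bigr => i _.
by rewrite -scalerAr lamZ [M i j]mxE.
Qed.

(* [Lam_1 lam(Lam_2)] *)
Definition modulus : H := \sum_i lam (w i Lam) *: b i.
Local Notation G := modulus.

(** Uniqueness of invariant functionals up to scalars: [kap] is invariant too, and writing it as
    [lam(_ k)], [lam_slide] gives [S k = kap(Lam) 1]. *)
Lemma lam_hcoef a h : lam (w a h) = lam (w a Lam) * lam h.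
Proof.
pose kap : {scalar H} := lam \o w a.
have [k kE] := lam_represent kap.
have kapI x : \sum_j kap (b j) *: w j x = kap x *: 1.
  rewrite /kap /= -lam_invariant.
  have Bb := bilin_scale H lam.
  by rewrite -(tlift_comul _ Bb) comul_hcoef tlift_sum.
have : S k = S (kap Lam *: 1).
  rewrite [RHS]linearZ /= antipode1 -kapI -lam_slide.
  by apply: eq_bigr => i _; rewrite kE.
move/antipode_inj=> {}kdef; rewrite -[LHS]/(kap h) kE kdef.
by rewrite -scalerAr mulr1 linearZ.
Qed.

Lemma coord_modulus a : c a G = lam (w a Lam).
Proof.
rewrite /modulus [LHS]linear_sum (bigD1 a) //= linearZ /= coord_bvec eqxx.
rewrite mulr1 big1 ?addr0 // => i nia.
by rewrite linearZ /= coord_bvec (negPf nia) mulr0.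
Qed.

Lemma lam_hcoef_sum h : \sum_i lam (w i h) *: b i = lam h *: G.
Proof.
rewrite scaler_sumr; apply: eq_bigr => i _.
by rewrite lam_hcoef scalerA mulrC.
Qed.

(** Grouplikeness of [G] in coordinates, from applying [lam] to the second leg of [comul_hcoef] at
    [Lam]. *)
Lemma hcoef_modulus j : w j G = c j G *: G.
Proof.
rewrite coord_modulus -lam_hcoef_sum /modulus [LHS]linear_sum.
have := congr1 (tlift (fun x y : H => lam y *: x)) (comul_hcoef j Lam).
have Bb := bilin_flip (bilin_scale H lam).
rewrite tlift_sum // tlift_comul // => ->.
by apply: eq_bigr => i _; rewrite [LHS]linearZ.
Qed.

Lemma comul_modulus : comul G = pure G G.
Proof.
rewrite comulE {2}(bvec_sum G).
transitivity (\sum_i pure (c i G *: b i) G).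
  apply: eq_bigr => i _; rewrite hcoef_modulus.
  by rewrite (bilinZl (pure_bilin H H)) (bilinZr (pure_bilin H H)).
by rewrite (bilin_suml (pure_bilin H H)).
Qed.

Lemma counit_modulus : eps G = 1.
Proof.
rewrite -lam_Lam /modulus [counit _]linear_sum -{2}(counit_bvec_hcoef Lam).
rewrite [RHS]linear_sum; apply: eq_bigr => i _.
by rewrite [LHS]linearZ [RHS]linearZ /= mulrC.
Qed.

Lemma antipode_integral : S Lam = Lam.
Proof.
apply: normalized_integral_uniq => //; split; last first.
  by rewrite [LHS]counit_antipode (counit_integral intLam).
move=> h; rewrite -{1 3}(antipode_invK h) -!antipodeM.
rewrite (integral_mulr intLam) (integral_mull intLam) !linearZ /=.
by rewrite counit_antipode_inv.
Qed.

(** Write [lam o S] as [lam(_ g)]. Then [lam_slide] gives [S g = lam(S(Lam_1)) Lam_2], and replacing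
    [Lam] by [S Lam] turns this into [S G]. *)
Lemma lam_antipode h : lam (S h) = lam (h * G).
Proof.
pose mu : {scalar H} := lam \o S.
have [g gE] := lam_represent mu.
suff -> : G = g by rewrite -gE.
apply: antipode_inj; rewrite -[RHS]lam_slide.
transitivity (\sum_i lam (S (b i)) *: w i Lam); last first.
  by apply: eq_bigr => i _; rewrite -gE.
have Bb : bilin (fun x y : H => lam (S x) *: y) by apply: (bilin_scale H mu).
rewrite -(tlift_comul _ Bb) -{1}antipode_integral comul_antipode tlift_sum //.
rewrite /modulus [LHS]linear_sum; apply: eq_bigr => i _.
by rewrite lam_antipode2 [LHS]linearZ.
Qed.

(** Test both sides against [lam (y * _)]. By [lam_antipode] the factor [G] can be traded for [S];
    one use of [lamM] under [S] and one outside contribute [T^2] each. *)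
Lemma modulus_conj x : x * G = G * T (T (T (T x))).
Proof.
apply/eqP; rewrite -subr_eq0; apply/eqP/lam_nondegenerate => y.
rewrite mulrBr lamB !mulrA -lam_antipode antipodeM.
have -> : lam (S x * S y) = lam (S (T (T x) * y)).
  rewrite lamM antipodeM; congr (lam (_ * _)).
  by rewrite antipodeK antipode_invK.
by rewrite lam_antipode -mulrA lamM subrr.
Qed.

End DualIntegral.

(** * Grouplike elements and matrices of finite order *)

Section Grouplike.
Variables (K : fieldType) (H : hopfAlgType K) (g : H).
Local Notation S := (antipode : 'End(H)).
Local Notation eps h := ((counit : 'Hom(H, K^o)) h : K).
Hypotheses (gg : comul g = pure g g) (g1 : eps g = 1).

Lemma comul_grouplike_exp k : comul (g ^+ k) = pure (g ^+ k) (g ^+ k).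
Proof.
elim: k => [|k IHk]; first by rewrite expr0 comul_1.
by rewrite exprS comul_M gg IHk tmul_pure.
Qed.

Lemma counit_grouplike_exp k : eps (g ^+ k) = 1.
Proof.
elim: k => [|k IHk]; first by rewrite expr0 counit_1.
by rewrite exprS counit_M g1 IHk mulr1.
Qed.

(* Distinct powers of g are linearly independent, so finite dimension forces   *)
(* a repetition.                                                               *)
Lemma grouplike_finite_order : exists2 m, (0 < m)%N & g ^+ m = 1.
Proof.
(* Here [k] is least with [g^0, ..., g^k] dependent, so [g ^+ k] is a combination of the lower
   powers, which are independent. *)
have [k fk nfk] : exists2 k, free (mkseq (fun i => g ^+ i) k) &
    ~~ free (mkseq (fun i => g ^+ i) k.+1).
  have ex : exists k, ~~ free (mkseq (fun i => g ^+ i) k).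
    exists (\dim {:H}).+1; apply/negP; rewrite /free size_mkseq => /eqP dimE.
    have := dimvS (subvf <<mkseq (fun i => g ^+ i) (\dim {:H}).+1>>).
    by rewrite dimE ltnn.
  have [[|k] nfk mink] := ex_minnP ex; first by rewrite nil_free in nfk.
  exists k => //; apply/negPn/negP => /mink; by rewrite ltnn.
pose X := [tuple of mkseq (fun i => g ^+ i) k].
have XE (i : 'I_k) : X`_i = g ^+ i by rewrite nth_mkseq.
have gX : g ^+ k \in <<X>>%VS.
  apply: contraR nfk => gnX; rewrite /mkseq -addn1 iotaD map_cat /= add0n.
  by rewrite (perm_free (permEl (perm_catC _ _))) /= free_cons gnX.
pose a i := coord X i (g ^+ k).
have gk : g ^+ k = \sum_i a i *: g ^+ i.
  by rewrite (coord_span gX); apply: eq_bigr => i _; rewrite XE.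
have cX i j : coord X i (g ^+ (j : 'I_k)) = (j == i)%:R by rewrite -XE coord_free.
(* The coefficient of [g^i (x) g^j] in [comul (g ^+ k)], computed in two ways. So each [a i] is 0 or
   1, and a nonzero one excludes all others. *)
have aa i j : a i * a j = a i *+ (i == j).
  have Bb : bilin (fun x y : H => coord X i x *: (coord X j y : K^o)).
    apply: (bilin_comp (f := id) (g := fun y => coord X j y : K^o)
      (bilin_scale K^o (coord X i : {scalar H}))) => // b x y.
    by rewrite linearP.
  have E1 : tlift (fun x y : H => coord X i x *: (coord X j y : K^o))
      (comul (g ^+ k)) = a i * a j.
    have := tlift_sum (fun _ : 'I_1 => g ^+ k) (fun=> g ^+ k) Bb.
    by rewrite !big_ord1 -comul_grouplike_exp.
  rewrite -E1 gk linear_sum /=.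
  have -> : \sum_i0 comul (a i0 *: g ^+ i0) = \sum_(l < k) pure (a l *: g ^+ l) (g ^+ l).
    apply: eq_bigr => l _; rewrite linearZ /= comul_grouplike_exp.
    by rewrite (bilinZl (pure_bilin H H)).
  rewrite tlift_sum // (bigD1 i) //= big1 ?addr0 => [|l /negPf nli].
    by rewrite linearZ /= !cX eqxx mulr1 [_ *: _]mulr_natr.
  by rewrite linearZ /= !cX nli mulr0 scale0r.
have suma : \sum_i a i = 1.
  rewrite -(counit_grouplike_exp k) gk [counit _]linear_sum; apply: eq_bigr => i _.
  by rewrite linearZ /= counit_grouplike_exp; rewrite [RHS]mulr1.
have [i ai0] : exists i, a i != 0.
  apply/existsP; apply: contraTT (oner_neq0 K) => /existsPn a0; rewrite negbK -suma.
  by rewrite big1 // => i _; apply/eqP; rewrite -[_ == _]negbK a0.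
have ai1 : a i = 1 by apply: (mulfI ai0); rewrite aa eqxx mulr1.
have gki : g ^+ k = g ^+ i.
  rewrite gk (bigD1 i) //= ai1 scale1r big1 ?addr0 // => j nji.
  by rewrite -[a j]mul1r -ai1 aa eq_sym (negPf nji) scale0r.
have Sg : S g * g = 1.
  have := antipode_l g; rewrite gg tlift_pure ?g1 ?scale1r //.
    by move=> v b x y; rewrite linearP mulrDl scalerAl.
  by move=> v b x y; rewrite mulrDr scalerAr.
have SgX j x : S g ^+ j * (g ^+ j * x) = x.
  elim: j x => [|j IHj] x; first by rewrite !mul1r.
  by rewrite exprSr exprS -2!mulrA (mulrA (S g)) Sg mul1r IHj.
exists (k - i)%N; first by rewrite subn_gt0.
rewrite -[LHS](SgX i) -exprD subnKC ?(ltnW (ltn_ord i)) // gki.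
by rewrite -[X in _ * X]mulr1 SgX.
Qed.

End Grouplike.

Section Positivity.
Variable C : numClosedFieldType.

Let hc m n (A : 'M[C]_(m, n)) := map_mx Num.conj A^T.

Let hcM m n p (A : 'M[C]_(m, n)) (B : 'M_(n, p)) : hc (A *m B) = hc B *m hc A.
Proof. by rewrite /hc trmx_mul map_mxM. Qed.

Let hcK m n (A : 'M[C]_(m, n)) : hc (hc A) = A.
Proof. by apply/matrixP => i j; rewrite !mxE conjCK. Qed.

Let hc_norm n (v : 'rV[C]_n) : (v *m hc v) 0 0 = \sum_i `|v 0 i| ^+ 2.
Proof. by rewrite mxE; apply: eq_bigr => i _; rewrite !mxE normCK. Qed.

(* The averaged form [sum_k (g^k)^* g^k] is positive definite and g-invariant. *)
Lemma mxtrace_inv_finite_order d (g : 'M[C]_d) N : (0 < N)%N ->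
  g ^+ N = 1%:M -> \tr (invmx g) = (\tr g)^*.
Proof.
move=> N_gt0 gN.
have gX1 : g *m g ^+ N.-1 = 1%:M by rewrite -gN -{2}(prednK N_gt0) exprS.
have [gU _] := mulmx1_unit gX1.
pose P := \sum_(k < N) hc (g ^+ k) *m g ^+ k.
(* Each summand is carried to the next one; [g ^+ N = 1] closes the cycle. *)
have gPg : hc g *m P *m g = P.
  rewrite mulmx_sumr mulmx_suml /P.
  rewrite (eq_bigr (fun k : 'I_N => hc (g ^+ k.+1) *m g ^+ k.+1)); last first.
    by move=> k _; rewrite exprSr [in RHS]hcM !mulmxA.
  case: N N_gt0 gN {gX1 P} => // N _ gN.
  rewrite big_ord_recr /= gN big_ord_recl /= addrC; congr (_ + _).
have P_unit : P \in unitmx.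
  rewrite -row_free_unit; apply: inj_row_free => v vP.
  have: \sum_(k < N) \sum_i `|(v *m hc (g ^+ k)) 0 i| ^+ 2 = 0.
    transitivity ((v *m P *m hc v) 0 0); last by rewrite vP mul0mx mxE.
    rewrite mulmx_sumr mulmx_suml summxE; apply: eq_bigr => k _.
    by rewrite -hc_norm hcM hcK !mulmxA.
  have nn k : 0 <= \sum_i `|(v *m hc (g ^+ k)) 0 i| ^+ 2.
    by apply: sumr_ge0 => i _; rewrite exprn_ge0.
  move/eqP; rewrite psumr_eq0; last by move=> k _; apply: nn.
  move/allP/(_ (Ordinal N_gt0)); rewrite mem_index_enum => /(_ isT) /=.
  have -> : hc (g ^+ 0) = 1%:M.
    by apply/matrixP => i j; rewrite !mxE rmorph_nat eq_sym.
  rewrite mulmx1 psumr_eq0 => [/allP v0|i _]; last by rewrite exprn_ge0.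
  apply/rowP => i; rewrite mxE; have := v0 i (mem_index_enum i).
  by rewrite expf_eq0 normr_eq0 => /eqP.
have PgP : invmx g = invmx P *m hc g *m P.
  by rewrite -mulmxA -[hc g *m P](mulmxK gU) gPg mulKmx.
rewrite PgP mxtrace_mulC mulmxA mulmxV // mul1mx.
by rewrite /mxtrace rmorph_sum; apply: eq_bigr => i _; rewrite !mxE.
Qed.

(** Since [g ^+ 2 = c h^-1], the power [g ^+ (2 * m)] is the scalar [c ^+ m]; a root of its inverse
    rescales [g]. *)
Lemma mx_normalize_finite_order d (g h : 'M[C]_d) c m :
    (0 < d)%N -> (0 < m)%N -> g \in unitmx -> h ^+ m = 1%:M -> h *m g *m g = c%:M ->
  exists2 z, z != 0 & (z *: g) ^+ (2 * m) = 1%:M.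
Proof.
case: d g h => // d g h _ m_gt0 gU hm hgg.
have hX1 : h *m h ^+ m.-1 = 1%:M by rewrite -hm -{2}(prednK m_gt0) exprS.
have hX2 : h ^+ m.-1 *m h = 1%:M by rewrite -hm -{2}(prednK m_gt0) exprSr.
have [hU _] := mulmx1_unit hX1.
have c0 : c != 0.
  apply: contraTneq (unitmx1 C d.+1) => c0; move: hgg; rewrite c0 => hgg.
  have : h *m g *m g \in unitmx by rewrite !unitmx_mul hU gU.
  by rewrite hgg raddf0 unitmxE det0 unitr0.
have gg : g ^+ 2 = c *: h ^+ m.-1.
  by rewrite expr2 -[LHS]mul1mx -hX2 -mulmxA (mulmxA h) hgg mul_mx_scalar.
have gX : g ^+ (2 * m) = (c ^+ m)%:M.
  by rewrite exprM gg exprZn -exprM mulnC exprM hm expr1n scalemx1.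
have m2 : (0 < 2 * m)%N by rewrite muln_gt0.
exists ((2 * m).-root (c ^- m)).
  by rewrite rootC_eq0 // invr_eq0 expf_eq0 negb_and c0 orbT.
by rewrite exprZn gX rootCK // scale_scalar_mx mulVf // expf_eq0 negb_and c0 orbT.
Qed.

End Positivity.

(** * The antipode is an involution *)

Section LarsonRadford.
Variables (C : numClosedFieldType) (H : hopfAlgType C).
Local Notation I := 'I_(\dim {:H}).
Local Notation b := (@bvec C H).
Local Notation c := (coord (vbasis {:H})).
Local Notation S := (antipode : 'End(H)).
Local Notation eps h := ((counit : 'Hom(H, C^o)) h : C).
Local Notation w := (@hcoef C H).
Local Notation u := (@ucoef C H).
Local Notation T := (@antipode_inv C H).
Local Notation lam := (@lam C H).

Variables (r : nat) (B : 'I_r -> matrix_block H).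
Hypothesis sumB : \sum_k bidem (B k) = 1.
Variable Lam : H.
Hypothesis intLam : normalized_integral Lam.

Let kerS : lker S == 0%VS := antipode_ker0 sumB.
Local Notation G := (@modulus C H Lam).

(** [T^2] is an algebra automorphism fixing the central idempotent of the block, so it acts on the
    block, and Skolem-Noether applies. *)
Lemma antipode_inv2_block k : exists2 g : 'M[C]_(bdeg (B k)), g \in unitmx &
  forall h, brep (B k) (T (T h)) = g *m brep (B k) h *m invmx g.
Proof.
pose th (X : 'M[C]_(bdeg (B k))) := brep (B k) (T (T (bemb (B k) X))).
have th_lin : linear th by move=> a X Y; rewrite /th !linearP.
pose Th : {linear 'M[C]_(bdeg (B k)) -> 'M[C]_(bdeg (B k))} := HB.pack th
  (GRing.isSemilinear.Build C _ _ _ th (GRing.semilinear_linear th_lin)).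
have Te : T (T (bidem (B k))) = bidem (B k).
  rewrite -{1}(antipode2_center intLam kerS (bidem_central (B k))).
  by rewrite !antipodeK.
have [X Y|//|g gU thE] := @matrix_automorphism_inner _ _ Th.
- by rewrite /= /th -bembM !(antipode_invM kerS) brepM.
- by rewrite /= /th -/(bidem _) Te brep_idem.
exists g => // h; rewrite -thE /= /th.
rewrite bemb_repl -/(bidem _) !(antipode_invM kerS) Te brepM.
by rewrite brep_idem mul1mx.
Qed.

(** With [X] the image of [G], [modulus_conj] says that [X *m g *m g] commutes with every matrix. As
    [X] has finite order, [g] can be rescaled to have finite order. *)
Lemma antipode_inv2_block_finite k : exists2 g : 'M[C]_(bdeg (B k)), 
  \tr (invmx g) = (\tr g)^* &
  forall h, brep (B k) (T (T h)) = g *m brep (B k) h *m invmx g.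
Proof.
have [g gU gE] := antipode_inv2_block k.
have [m m_gt0 Gm] := grouplike_finite_order (comul_modulus intLam kerS)
  (counit_modulus intLam kerS).
pose X := brep (B k) G.
have Xj j : brep (B k) (G ^+ j) = X ^+ j.
  elim: j => [|j IHj]; first by rewrite !expr0 brep1.
  by rewrite !exprS brepM IHj.
have Xm : X ^+ m = 1%:M by rewrite -Xj Gm brep1.
have [d Xd] : exists d, X *m g *m g = d%:M.
  apply: commutant_scalar => Y.
  have := congr1 (brep (B k)) (modulus_conj intLam kerS (bemb (B k) Y)).
  rewrite !brepM bembK !gE bembK -/X => E.
  rewrite !mulmxA E !mulmxA.
  by rewrite !mulmxKV.
have [z z0 gz] := mx_normalize_finite_order (bdeg_gt0 (B k)) m_gt0 gU Xm Xd.
exists (z *: g); first by apply: mxtrace_inv_finite_order gz; rewrite muln_gt0.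
move=> h; rewrite gE invmxZ ?unitmxZ ?unitfE //.
by rewrite -!scalemxAl -scalemxAr scalerA mulfV ?scale1r.
Qed.

(** Blockwise, [lam h] is the sum of [\tr (h g_k)] times the conjugate of [\tr g_k], so [lam 1] is a
    sum of squared moduli. Its vanishing would kill [lam], against [lam_Lam]. *)
Lemma lam1_neq0 : lam 1 != 0.
Proof.
have blk k : {g : 'M[C]_(bdeg (B k)) | \tr (invmx g) = (\tr g)^* /\
    forall h, brep (B k) (T (T h)) = g *m brep (B k) h *m invmx g}.
  by apply: cid; have [g] := antipode_inv2_block_finite k; exists g.
pose g k := sval (blk k).
have lamtr h : lam h = \sum_k \tr (brep (B k) h *m g k) * (\tr (g k))^*.
  rewrite -[LHS]/(lftrace _) (lftrace_blocks sumB); apply: eq_bigr => k _.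
  have [gt gE] := svalP (blk k); rewrite -/(g k) in gt gE.
  rewrite -gt -sum_delta_conj; apply: eq_bigr => i _; apply: eq_bigr => j _.
  by rewrite !comp_lfunE lfunE /= brepM gE bembK !mulmxA.
apply/eqP => lam1.
have trg k : \tr (g k) = 0.
  have: lam 1 = \sum_k `|\tr (g k)| ^+ 2.
    by rewrite lamtr; apply: eq_bigr => l _; rewrite brep1 mul1mx normCK.
  rewrite lam1 => /esym/eqP; rewrite psumr_eq0 => [/allP/(_ k)|l _];
    last by rewrite exprn_ge0.
  by rewrite mem_index_enum expf_eq0 normr_eq0 => /(_ isT)/eqP.
have := lam_Lam intLam kerS; rewrite lamtr big1 => [/esym/eqP|k _].
  by rewrite oner_eq0.
by rewrite trg rmorph0 mulr0.
Qed.

(** At [h = 1], [lam_hcoef_sum] reads [lam 1 *: 1 = lam 1 *: G], so [G = 1] and [modulus_conj] loses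
    its twist. *)
Lemma antipode4 x : S (S (S (S x))) = x.
Proof.
have G1 : G = 1.
  apply: (scalerI lam1_neq0); rewrite -(lam_hcoef_sum intLam kerS).
  have Bb := bilin_flip (bilin_scale H lam).
  rewrite -(tlift_comul _ Bb) comul_1.
  by have := tlift_sum (fun _ : 'I_1 => 1) (fun=> 1) Bb; rewrite !big_ord1.
have := modulus_conj intLam kerS (S (S (S (S x)))).
by rewrite G1 mul1r mulr1 !antipodeK.
Qed.

Lemma antipode_inv2E x : T (T x) = S (S x).
Proof. by rewrite -{1}(antipode4 x) !antipodeK. Qed.

Lemma antipode2_sum (J : finType) (a : J -> C) (v : J -> H) :
  S (S (\sum_i a i *: v i)) = \sum_i a i *: S (S (v i)).
Proof. by rewrite !linear_sum; apply: eq_bigr => i _; rewrite !linearZ. Qed.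

(* x_1 (x) h x_2 = S(h_1) (h_2 x)_1 (x) (h_2 x)_2 *)
Lemma mul_comul_slide (W : vectType C) (F : H -> H -> W) h x : bilin F ->
  \sum_i F (b i) (h * w i x) =
  \sum_j \sum_i F (S (b j) * b i) (w i (w j h * x)).
Proof.
move=> Fb.
have E j : \sum_i F (S (b j) * b i) (w i (w j h * x)) =
    \sum_k \sum_m F (S (b j) * (u j k * b m)) (w k h * w m x).
  pose F' y z := F (S (b j) * y) z.
  have Fb' : bilin F'.
    apply: (bilin_comp (f := fun y => S (b j) * y) (g := id) Fb) => // a y z.
    by rewrite mulrDr scalerAr.
  rewrite -(tlift_comul _ Fb') (comulM_sum (comul_hcoef j h) (comulE x)).
  rewrite pair_big tlift_sum //.
  by rewrite -(pair_big xpredT xpredT (fun k m => F' (u j k * b m) (w k h * w m x))).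
under [RHS]eq_bigr do rewrite E.
rewrite exchange_big /=.
transitivity (\sum_k \sum_m F (eps (b k) *: b m) (w k h * w m x)); last first.
  apply: eq_bigr => k _; rewrite exchange_big; apply: eq_bigr => m _ /=.
  rewrite -(bilin_suml Fb); congr (F _ _).
  under eq_bigr do rewrite mulrA; rewrite -mulr_suml.
  by rewrite -(tlift_comul _ (bilin_antipode_mul H)) antipode_l -scalerAl mul1r.
rewrite exchange_big; apply: eq_bigr => m _ /=.
rewrite -{1}(counit_bvec_hcoef h) mulr_suml (bilin_sumr Fb); apply: eq_bigr => k _.
by rewrite -scalerAl (bilinZr Fb) (bilinZl Fb).
Qed.

(* tr(S^2 u), the regular character of H^* twisted by S^2 *)
Definition antipode2_element : H := \sum_i w i (S (S (b i))).
Local Notation Z := antipode2_element.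

(** After [mul_comul_slide], what remains of [h] is [h_2 S^3(h_1)]. Its image under [S] is
    [h_1 S(h_2)] because [S^4 = 1], hence it equals [eps(h) 1]. *)
Lemma antipode2_element_integral h : h * Z = eps h *: Z.
Proof.
rewrite mulr_sumr.
transitivity (\sum_a \sum_j \sum_i c a (S (b j) * b i) *: w i (w j h * S (S (b a)))).
  apply: eq_bigr => a _.
  rewrite -(mul_comul_slide _ _ (bilin_scale H (c a : {scalar H}))).
  rewrite (bigD1 a) //= coord_bvec eqxx scale1r big1 ?addr0 // => i nia.
  by rewrite coord_bvec (negPf nia) scale0r.
rewrite exchange_big /=.
transitivity (\sum_j \sum_i w i (w j h * S (S (S (b j))) * S (S (b i)))).
  apply: eq_bigr => j _; rewrite exchange_big; apply: eq_bigr => i _ /=.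
  rewrite -mulrA -!antipodeM; move: (S (b j) * b i) => y.
  have SSy : S (S y) = \sum_a c a y *: S (S (b a)).
    by rewrite {1}(bvec_sum y) antipode2_sum.
  rewrite SSy mulr_sumr [RHS]linear_sum; apply: eq_bigr => a _.
  by rewrite -scalerAr [RHS]linearZ.
rewrite exchange_big scaler_sumr; apply: eq_bigr => i _ /=.
rewrite -linear_sum -mulr_suml -[RHS]linearZ; congr (w i _).
rewrite -[RHS]mul1r -scalerAr scalerAl; congr (_ * _).
apply: (antipode_inj kerS); rewrite [LHS]linear_sum [RHS]linearZ /= antipode1.
have Bb := bilin_mul_antipode H.
rewrite -antipode_r (tlift_comul _ Bb); apply: eq_bigr => j _.
by rewrite antipodeM antipode4.
Qed.

(** [Z = Lam * Z = eps(Z) Lam] by the integral property on both sides, and [eps(Z)] is the trace of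
    [T^2]. *)
Lemma antipode2_elementE : Z = lam 1 *: Lam.
Proof.
rewrite -[LHS]scale1r -{1}(counit_integral intLam) -antipode2_element_integral.
rewrite (integral_mulr intLam).
congr (_ *: _); rewrite /antipode2_element [counit _]linear_sum lamE.
apply: eq_bigr => i _; rewrite [LHS]/= [LHS]counit_hcoef -antipode_inv2E.
rewrite {1}(bvec_sum (T (T (b i)))) [LHS]linear_sum; apply: eq_bigr => j _.
by rewrite [LHS]linearZ /= mulrC mul1r.
Qed.

Let n := \dim {:H}.

Let chi_fun (h : H) : C := lftrace (amull h).

Let chi_linear : scalar chi_fun.
Proof. by move=> a x y; rewrite /chi_fun -lftraceZ -lftraceD linearP. Qed.

Definition regular_char : {scalar H} := HB.pack chi_fun
  (GRing.isSemilinear.Build C H C _ _ (GRing.semilinear_linear chi_linear)).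
Local Notation chi := regular_char.

Lemma regular_charC x y : chi (x * y) = chi (y * x).
Proof.
rewrite -[LHS]/(lftrace _) -[RHS]/(lftrace _).
have amullM (g h : H) : amull (g * h) = (amull g \o amull h)%VF.
  by apply/lfunP => z; rewrite comp_lfunE !lfunE /= mulrA.
by rewrite !amullM lftraceC.
Qed.

Lemma regular_char1 : chi 1 = n%:R.
Proof.
rewrite -[LHS]/(lftrace _) -lftrace1; congr lftrace.
by apply/lfunP => z; rewrite !lfunE /= mul1r.
Qed.

Lemma regular_char_Lam : chi Lam = 1.
Proof.
rewrite -[LHS]/(lftrace _).
rewrite (@lftrace_finrank _ _ 'I_1 _ (fun=> counit_scalar H) (fun=> Lam)).
  by rewrite big_ord1; apply: (counit_integral intLam).
by move=> x; rewrite big_ord1 lfunE /= (integral_mulr intLam).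
Qed.

Lemma regular_char_antipode2 x : chi (S (S x)) = chi x.
Proof.
rewrite -[LHS]/(lftrace _) -[RHS]/(lftrace _).
have -> : amull (S (S x)) = ((S \o S) \o (amull x \o (S \o S)))%VF.
  by apply/lfunP => z; rewrite !comp_lfunE !lfunE /= !antipodeM !antipode4.
rewrite lftraceC; congr lftrace; apply/lfunP => z.
by rewrite !comp_lfunE !lfunE /= antipode4.
Qed.

(** By [lmul_comul], [chi(h_1) h_2] is the trace of [u [h] S(u)]. Under the symmetric functional
    [chi] the factors [u] and [S(u)] can be brought together and cancel. *)
Lemma regular_char_conv h : \sum_i chi (b i) * chi (w i h) = n%:R * chi h.
Proof.
have chiE x : chi x = \sum_a c a (x * b a).
  by apply: eq_bigr => a _; rewrite lfunE.
have -> : \sum_i chi (b i) * chi (w i h) = chi (\sum_a \sum_i c a (b i * b a) *: w i h).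
  rewrite exchange_big [RHS]linear_sum; apply: eq_bigr => i _.
  by rewrite -scaler_suml -chiE [RHS]linearZ.
have -> : \sum_a \sum_i c a (b i * b a) *: w i h =
    \sum_k \sum_l c l (h * b k) *: \sum_a u a l * S (u k a).
  under eq_bigr do rewrite lmul_comul.
  rewrite exchange_big; apply: eq_bigr => k _ /=.
  by rewrite exchange_big; apply: eq_bigr => l _ /=; rewrite -scaler_sumr.
rewrite [in RHS]chiE mulr_sumr [LHS]linear_sum; apply: eq_bigr => k _.
rewrite [LHS]linear_sum.
have chi_us l : chi (\sum_a u a l * S (u k a)) = (k == l)%:R * n%:R.
  transitivity (chi (\sum_a S (u k a) * u a l)).
    rewrite [LHS]linear_sum [RHS]linear_sum; apply: eq_bigr => a _.
    exact: regular_charC.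
  rewrite antipode_ucoef_l -regular_char1; case: (k == l); rewrite ?mul1r //.
  by rewrite mul0r; apply: linear0.
rewrite (eq_bigr (fun l => c l (h * b k) * ((k == l)%:R * n%:R))); last first.
  by move=> l _; rewrite [LHS]linearZ chi_us.
rewrite (bigD1 k) //= big1 ?addr0 => [|l nlk]; first by rewrite eqxx mul1r mulrC.
by rewrite eq_sym (negPf nlk) mul0r mulr0.
Qed.

(* E is n times the idempotent of the convolution algebra given by chi / n, and  *)
(* S^2 E has trace chi(tr(S^2 u)) = chi(Tr(S^2) Lam) = Tr(S^2).                  *)
Let E_fun (x : H) : H := \sum_i chi (w i x) *: b i.

Let E_linear : linear E_fun.
Proof.
have chiP a x y : chi (a *: x + y) = a * chi x + chi y by apply: linearP.
move=> a x y; rewrite /E_fun scaler_sumr -big_split; apply: eq_bigr => i _.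
by rewrite linearP chiP scalerDl scalerA.
Qed.

Let E : 'End(H) := linfun (HB.pack_for {linear H -> H} E_fun
  (GRing.isSemilinear.Build C H H _ E_fun (GRing.semilinear_linear E_linear))).

Let EE x : E x = \sum_i chi (w i x) *: b i.
Proof. by rewrite lfunE. Qed.

Let E2 x : E (E x) = n%:R *: E x.
Proof.
transitivity (E (\sum_i chi (w i x) *: b i)); first by rewrite -EE.
rewrite [in RHS]EE scaler_sumr [LHS]linear_sum.
transitivity (\sum_i \sum_j (chi (w i x) * chi (u j i)) *: b j).
  apply: eq_bigr => i _; rewrite linearZ /= EE scaler_sumr.
  by apply: eq_bigr => j _; rewrite scalerA.
rewrite exchange_big; apply: eq_bigr => j _ /=.
rewrite -scaler_suml scalerA; congr (_ *: _).
rewrite -regular_char_conv.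
have Bb : bilin (fun y z : H => chi y *: (chi z : C^o)).
  apply: (bilin_comp (f := id) (g := fun z => chi z : C^o) (bilin_scale C^o chi)) => //.
have := tlift_comul (w j x) Bb; rewrite comul_hcoef tlift_sum // => <-.
by apply: eq_bigr => i _; rewrite mulrC.
Qed.

Let SSE x : E (S (S x)) = S (S (E x)).
Proof.
have Bb := bilin_flip (bilin_scale H chi).
rewrite !EE -(tlift_comul _ Bb) comul_antipode2 tlift_sum //.
rewrite antipode2_sum; apply: eq_bigr => i _.
by rewrite regular_char_antipode2.
Qed.

Lemma lftrace_antipode2 : lftrace (S \o S)%VF = lam 1.
Proof.
rewrite -[RHS]/(lftrace _); congr lftrace; apply/lfunP => x.
by rewrite !comp_lfunE lfunE /= mul1r antipode_inv2E.
Qed.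

(** [(E + F) / 2n] and [(E - F) / 2n] are idempotents, so their traces are dimensions; the
    difference of these is [lftrace F / n]. *)
Lemma lftrace_antipode2_dvd : exists a d : nat,
  lftrace (S \o S)%VF = n%:R * (a%:R - d%:R).
Proof.
have n0 : n%:R != 0 :> C.
  rewrite pnatr_eq0 dimv_eq0; apply/eqP => H0.
  by have := memvf (1 : H); rewrite H0 memv0 oner_eq0.
pose F : 'End(H) := ((S \o S) \o E)%VF.
have trF : lftrace F = lftrace (S \o S)%VF.
  pose cc i : {scalar H} := chi \o w i.
  rewrite (@lftrace_finrank _ _ _ _ cc (fun i => S (S (b i)))); last first.
    by move=> x; rewrite !comp_lfunE EE antipode2_sum.
  transitivity (chi Z); first by rewrite [RHS]linear_sum.
  rewrite antipode2_elementE [LHS]linearZ regular_char_Lam lftrace_antipode2.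
  exact: mulr1.
pose p s : 'End(H) := ((2 * n%:R)^-1 : C) *: (E + (-1) ^+ s *: F).
have n2 : 2 * n%:R != 0 :> C by rewrite mulf_neq0 // pnatr_eq0.
have pE s x : p s x = (2 * n%:R)^-1 *: (E x + (-1) ^+ s *: F x).
  by rewrite scale_lfunE add_lfunE scale_lfunE.
have FE y : F y = S (S (E y)) by rewrite !comp_lfunE.
have EF y : E (F y) = n%:R *: F y by rewrite FE SSE E2 !linearZ.
have FEn y : F (E y) = n%:R *: F y by rewrite !FE E2 !linearZ.
have FF y : F (F y) = n%:R *: E y by rewrite [LHS]FE FE SSE antipode4 E2.
have pp (s : bool) : (p s \o p s)%VF = p s.
  apply/lfunP => x; rewrite comp_lfunE; pose e : C := (-1) ^+ s.
  have ee : e * e = 1 by rewrite -expr2 sqrr_sign.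
  have Ep : E (p s x) = ((2 * n%:R)^-1 * n%:R) *: (E x + e *: F x).
    rewrite pE linearZ -scalerA; congr (_ *: _).
    by rewrite linearD linearZ /= E2 EF scalerDr !scalerA mulrC.
  have Fp : F (p s x) = ((2 * n%:R)^-1 * n%:R) *: (F x + e *: E x).
    rewrite pE linearZ -scalerA; congr (_ *: _).
    by rewrite linearD linearZ /= FF FEn scalerDr !scalerA mulrC.
  rewrite [LHS]pE Ep Fp -/e pE -/e; congr (_ *: _).
  have kn2 : (2 * n%:R)^-1 * n%:R *+ 2 = 1 :> C by rewrite -mulr_natl mulrCA mulVf.
  have -> : e *: (((2 * n%:R)^-1 * n%:R) *: (F x + e *: E x)) =
      ((2 * n%:R)^-1 * n%:R) *: (E x + e *: F x).
    rewrite scalerA (mulrC e) -[LHS]scalerA; congr (_ *: _).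
    by rewrite scalerDr scalerA ee scale1r addrC.
  by rewrite -scalerDl -mulr2n kn2 scale1r.
have trp s : lftrace (p s) =
    (2 * n%:R)^-1 * (lftrace E + (-1) ^+ s * lftrace (S \o S)%VF).
  by rewrite lftraceZ lftraceD lftraceZ trF.
exists (\dim (limg (p false))), (\dim (limg (p true))).
by rewrite -!lftrace_idem // !trp expr0 expr1; field.
Qed.

Theorem antipode_involutive x : S (S x) = x.
Proof.
have [m trE [m_le m0 mn]] : exists2 m : nat, lftrace (S \o S)%VF = n%:R - (m.*2)%:R &
    [/\ (m <= n)%N, m = 0%N -> (S \o S)%VF = \1%VF & m = n -> (S \o S)%VF = (- \1)%VF].
  apply: lftrace_involution; first by rewrite pnatr_eq0.
  by apply/lfunP => y; rewrite !comp_lfunE id_lfunE antipode4.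
have [a [d trE']] := lftrace_antipode2_dvd.
have tr0 : lftrace (S \o S)%VF != 0 by rewrite lftrace_antipode2 lam1_neq0.
have eqZ : (n%:Z - (m.*2)%:Z = n%:Z * (a%:Z - d%:Z))%R.
  apply/eqP; rewrite -(eqr_int C) intrM !intrB -!pmulrn -trE trE'.
  by rewrite eqxx.
have nm : n <> m.*2 by move=> nm; case/eqP: tr0; rewrite trE {1}nm subrr.
(* Now [n - 2m = n q] with [m <= n]. The case [q = 0] contradicts [nm], [q = 1] gives [m = 0],
   [q = -1] gives [m = n], and [|q| >= 2] would force [n = m = 0]. *)
have [m_0 | /mn SSN] : m = 0%N \/ m = n.
  move: eqZ; set q := (a%:Z - d%:Z)%R => eqZ.
  have [q0|[q1|[q1|[q2|q2]]]] : (q = 0 \/ q = 1 \/ q = -1 \/ q >= 2 \/ q <= -2)%R by lia.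
  - by case: nm; rewrite q0 in eqZ; lia.
  - by left; rewrite q1 in eqZ; lia.
  - by right; rewrite q1 in eqZ; lia.
  - by left; nia.
  by left; nia.
  by rewrite -[RHS]id_lfunE -(m0 m_0) comp_lfunE.
(* [S^2 = -1] is impossible because [S] fixes 1. *)
have := congr1 (fun f : 'End(H) => f 1) SSN.
rewrite comp_lfunE opp_lfunE id_lfunE !antipode1 => /eqP.
rewrite -subr_eq0 opprK -mulr2n -scaler_nat scaler_eq0 oner_eq0 pnatr_eq0.
by [].
Qed.

End LarsonRadford.

(** * Frobenius-Schur indicators *)

Section BlockModule.
Variables (K : fieldType) (A : falgType K) (B : matrix_block A).

Definition block_char (a : A) : K := \tr (brep B a).

(** The module is the space of column vectors; matrix units carry any nonzero vector to multiples of
    all basis vectors. *)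
Lemma block_char_irreducible : irreducible_char block_char.
Proof.
pose V := 'cV[K]_(bdeg B).
pose f a : 'End(V) := linfun (mulmx (brep B a)).
have f_lin : linear f.
  move=> x a a'; apply/lfunP => v.
  by rewrite add_lfunE scale_lfunE !lfunE /= linearP mulmxDl -scalemxAl.
pose F : 'Hom(A, 'End(V)) := linfun (HB.pack_for {linear A -> 'End(V)} f
  (GRing.isSemilinear.Build K A 'End(V) _ f (GRing.semilinear_linear f_lin))).
have FE a v : F a v = brep B a *m v by rewrite lfunE /= lfunE.
have F1 : F 1 = \1%VF by apply/lfunP => v; rewrite FE brep1 mul1mx id_lfunE.
have FM a a' : F (a * a') = (F a \o F a')%VF.
  by apply/lfunP => v; rewrite comp_lfunE !FE brepM mulmxA.
exists (AModule F1 FM); last first.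
  apply: funext => a; rewrite /character /block_char /=.
  have entry_lin i : scalar (fun v : V => v i 0) by move=> x v v'; rewrite !mxE.
  pose c i : {scalar V} := HB.pack (fun v : V => v i 0)
    (GRing.isSemilinear.Build K V K _ _ (GRing.semilinear_linear (entry_lin i))).
  rewrite (@lftrace_basis _ _ _ _ c (fun i => delta_mx i 0)).
    by apply: eq_bigr => i _; rewrite FE -colE /= mxE.
  move=> v; rewrite {1}[v]matrix_sum_delta; apply: eq_bigr => i _.
  by rewrite big_ord1.
split=> [|U sU] /=.
  apply/eqP => V0; have := memvf (const_mx 1 : V); rewrite V0 memv0 => /eqP.
  move/matrixP/(_ (Ordinal (bdeg_gt0 B)) 0); rewrite !mxE => /eqP.
  by rewrite oner_eq0.
have [-> | U0] := eqVneq U 0%VS; [by left | right].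
have Uv := memv_pick U; set v := vpick U in Uv.
have /matrix0Pn[p [q vpq]] : (v : 'M_(_, _)) != 0 by rewrite vpick0.
apply/eqP; rewrite eqEsubv subvf; apply/subvP => x _.
have -> : x = \sum_i ((v p q)^-1 * x i 0) *: (delta_mx i p *m v : V).
  apply/matrixP => i j; rewrite !ord1 in vpq *; rewrite summxE (bigD1 i) //= mxE mxE.
  rewrite (bigD1 p) //= mxE !eqxx mul1r big1 ?addr0 => [|l nlp]; last first.
    by rewrite mxE (negPf nlp) andbF mul0r.
  rewrite big1 ?addr0 => [|l nli]; first by rewrite mulrAC mulVf ?mul1r.
  rewrite mxE mxE big1 ?mulr0 // => m _.
  by rewrite mxE eq_sym (negPf nli) mul0r.
apply: rpred_sum => i _; apply: rpredZ.
have /subvP/(_ _ (memv_img _ Uv)) := sU (bemb B (delta_mx i p)).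
by rewrite /= FE bembK.
Qed.

End BlockModule.

Section FrobeniusSchur.
Variables (C : numClosedFieldType) (H : hopfAlgType C).
Local Notation S := (antipode : 'End(H)).
Local Notation eps h := ((counit : 'Hom(H, C^o)) h : C).
Local Notation b := (@bvec C H).
Local Notation w := (@hcoef C H).
Local Notation lam := (@lam C H).
Variables (r : nat) (B : 'I_r -> matrix_block H).
Hypothesis orthB : forall k l, k != l -> bidem (B k) * bidem (B l) = 0.
Hypothesis sumB : \sum_k bidem (B k) = 1.
Variable Lam : H.
Hypothesis intLam : normalized_integral Lam.

Let SK : involutive S := antipode_involutive sumB intLam.

(* The trace of the endomorphism induced by S on the k-th block. *)
Definition block_trace k : C :=
  \sum_i \sum_j brep (B k) (S (bemb (B k) (delta_mx i j))) i j.

Lemma lftrace_antipode : lftrace S = \sum_k block_trace k.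
Proof. exact: lftrace_blocks. Qed.

Lemma LambdaE : Lambda H = Lam.
Proof.
rewrite /Lambda; case: xgetP => [x -> xint|/(_ Lam)//].
exact: normalized_integral_uniq.
Qed.

(** As [T^2 = 1], [lam] is now the regular character. *)
Lemma lam_blocks h : lam h = \sum_k (bdeg (B k))%:R * block_char (B k) h.
Proof.
rewrite -[LHS]/(lftrace _) (lftrace_blocks sumB); apply: eq_bigr => k _.
rewrite mulrC -mxtrace1 -sum_delta_conj; apply: eq_bigr => i _; apply: eq_bigr => j _.
rewrite !comp_lfunE lfunE /= (antipode_inv2E sumB intLam) SK brepM bembK.
by rewrite mulmx1.
Qed.

(** Entries of [brep] are values of [lam] against matrix units, up to the degree. Expanding the
    trace of [Lam_1 Lam_2] in entries, [lam_slide] turns the sum over [Lam] into [S] of a matrix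
    unit. *)
Lemma nu2_block k : (bdeg (B k))%:R * nu2 (block_char (B k)) = block_trace k.
Proof.
have kerS := antipode_ker0 sumB.
have lam_entry h p q : lam (h * bemb (B k) (delta_mx q p)) =
    (bdeg (B k))%:R * brep (B k) h p q.
  rewrite lam_blocks (bigD1 k) //= big1 ?addr0 => [|l nlk]; last first.
    by rewrite /block_char brepM brep_bemb_neq // mulmx0 linear0 mulr0.
  congr (_ * _); rewrite /block_char brepM bembK /mxtrace (bigD1 p) //=.
  rewrite big1 ?addr0 => [|i nip].
    rewrite mxE (bigD1 q) //= mxE !eqxx mulr1 big1 ?addr0 // => j njq.
    by rewrite mxE (negPf njq) mulr0.
  by rewrite mxE big1 // => j _; rewrite mxE (negPf nip) andbF mulr0.
rewrite /nu2 LambdaE (tlift_comul _ (bilin_mul H)) /block_char.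
rewrite linear_sum linear_sum /= mulr_sumr.
transitivity (\sum_i \sum_q \sum_p lam (b i * bemb (B k) (delta_mx q p)) *
    brep (B k) (w i Lam) q p).
  apply: eq_bigr => i _; rewrite brepM mxtrace_mulC /mxtrace mulr_sumr.
  apply: eq_bigr => q _; rewrite mxE mulr_sumr; apply: eq_bigr => p _.
  by rewrite lam_entry mulrA mulrAC.
rewrite exchange_big; apply: eq_bigr => q _ /=.
rewrite exchange_big; apply: eq_bigr => p _ /=.
rewrite -(lam_slide intLam kerS) linear_sum summxE; apply: eq_bigr => i _.
by rewrite linearZ mxE.
Qed.

(* On a block stable by S, S(X) = a^-1 X^T a with a^T = +/- a. *)
Lemma block_trace_cases k : block_trace k = 0 \/
  [/\ block_trace k = (bdeg (B k))%:R \/ block_trace k = - (bdeg (B k))%:R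
    & forall h, block_char (B k) (S h) = block_char (B k) h].
Proof.
set e := bidem (B k).
have Ssurj h : exists h', h = S h' by exists (S h); rewrite SK.
have SeC h : S e * h = h * S e.
  have [h' ->] := Ssurj h; rewrite -!antipodeM.
  by rewrite bidem_central.
(* [S e] is a central idempotent, so its image in the block is 0 or 1: either [S] moves the block
   off itself and the trace vanishes, or [S] preserves it. *)
have [c cE] : exists c, brep (B k) (S e) = c%:M.
  apply: commutant_scalar => X; rewrite -(bembK X) -!brepM.
  by rewrite SeC.
have cc : c * c = c.
  have := congr1 (brep (B k)) (congr1 S (bidemK (B k))).
  rewrite antipodeM brepM cE -scalar_mxM => /matrixP.
  by move/(_ (Ordinal (bdeg_gt0 (B k))) (Ordinal (bdeg_gt0 (B k)))); rewrite !mxE eqxx.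
have repS h : brep (B k) (S (h * e)) = c *: brep (B k) (S h).
  by rewrite antipodeM brepM cE mul_scalar_mx.
have [c0 | c0] := eqVneq c 0.
  left; rewrite /block_trace big1 // => i _; rewrite big1 // => j _.
  by rewrite -bidem_emb -/e bidem_central repS c0 scale0r mxE.
right; have c1 : c = 1 by apply: (mulIf c0); rewrite cc mul1r.
(* [S] reverses products, so composing it with the transpose gives an automorphism of the matrix
   algebra, inner by Skolem-Noether. *)
pose th (X : 'M[C]_(bdeg (B k))) := (brep (B k) (S (bemb (B k) X)))^T.
have th_lin : linear th by move=> a X Y; rewrite /th !linearP.
pose Th : {linear 'M[C]_(bdeg (B k)) -> 'M[C]_(bdeg (B k))} := HB.pack th
  (GRing.isSemilinear.Build C _ _ _ th (GRing.semilinear_linear th_lin)).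
have [X Y||g gU thE] := @matrix_automorphism_inner _ _ Th.
- by rewrite /= /th -bembM antipodeM brepM trmx_mul.
- by rewrite /= /th -/(bidem _) -/e cE c1 trmx1.
have [a ga] : exists a, g = a^T by exists g^T; rewrite trmxK.
have aU : a \in unitmx by rewrite -unitmx_tr -ga.
have repSE h : brep (B k) (S h) = invmx a *m (brep (B k) h)^T *m a.
  have -> : brep (B k) (S h) = (th (brep (B k) h))^T.
    by rewrite /th trmxK bemb_repr -/(bidem _) -/e repS c1 scale1r.
  by rewrite -[th _]/(Th _) thE ga !trmx_mul trmx_inv !trmxK mulmxA.
(* Applying [repSE] twice with [S^2 = 1] shows that [a^-1 a^T] commutes with all matrices.
   Transposing [a^T = d *: a] once more yields [d * d = 1]. *)
have [d dE] : exists d, invmx a *m a^T = d%:M.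
  apply: commutant_scalar => X.
  have := repSE (S (bemb (B k) X)); rewrite SK bembK repSE bembK.
  rewrite !trmx_mul trmxK trmx_inv => XE.
  by rewrite {2}XE !mulmxA mulmxK // mulmxKV // unitmx_tr.
have aT : a^T = d *: a by rewrite -(mulKVmx aU a^T) dE mul_mx_scalar.
have dd : d * d = 1.
  have : a = (d * d) *: a by rewrite -{1}(trmxK a) aT linearZ /= aT scalerA.
  move/(congr1 (mulmx (invmx a))); rewrite -scalemxAr mulVmx // => /matrixP.
  move/(_ (Ordinal (bdeg_gt0 (B k))) (Ordinal (bdeg_gt0 (B k)))).
  by rewrite !mxE eqxx mulr1.
(* The trace of [X |-> a^-1 X^T a] is the trace of [a^-1 a^T]. *)
have trE : block_trace k = d * (bdeg (B k))%:R.
  rewrite -mxtrace1 -mxtraceZ scalemx1 -dE /mxtrace; apply: eq_bigr => i _.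
  rewrite mxE; apply: eq_bigr => j _; rewrite repSE bembK trmx_delta.
  rewrite -mulmxA mxE (bigD1 j) //= mxE (bigD1 i) //= mxE !eqxx mul1r mxE.
  rewrite big1 ?addr0 => [|l nli]; last by rewrite mxE (negPf nli) andbF mul0r.
  rewrite big1 ?addr0 // => l nlj; rewrite mxE big1 ?mulr0 // => m _.
  by rewrite mxE (negPf nlj) mul0r.
split.
  have /eqP : (d - 1) * (d + 1) = 0 by rewrite -subr_sqr_1 expr2 dd subrr.
  rewrite mulf_eq0 subr_eq0 addr_eq0 trE => /orP[] /eqP ->; first by left; rewrite mul1r.
  by right; rewrite mulN1r.
move=> h; rewrite /block_char repSE mxtrace_mulC mulmxA mulmxV // mul1mx.
exact: mxtrace_tr.
Qed.

End FrobeniusSchur.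

(** * The degree bound *)

(** Here [k0] stands for the trivial character, [e] for the indicators, [d] for the degrees. Put
    [M = |N - 1|]. If no [k] works, then [n <= d k * M] for all relevant [k], and summing over them
    [M n <= \sum d k n <= M \sum (d k)^2 <= M (n - 1)]. *)
Lemma small_degree_exists (I : finType) (k0 : I) (e : I -> int) (d : I -> nat)
    (s : int) (n : nat) (N : int) :
    (forall k, `|e k| <= 1) -> `|s| = 1 -> (d k0 = 1)%N -> e k0 = 1 ->
    (n = \sum_k d k ^ 2)%N -> N = \sum_k e k * (d k)%:Z -> 0 < s * (N - 1) ->
  exists k, [/\ k != k0, e k = s & (d k)%:Z * `|N - 1| <= n%:Z - 1].
Proof.
move=> e1 s1 d0 e0 nE NE M_gt0; apply: contrapT => /forallNP noex.
have s_cases : s = 1 \/ s = -1 by lia.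
set M := s * (N - 1) in M_gt0.
have ME : `|N - 1| = M.
  by have := normrM s (N - 1); rewrite s1 mul1r => <-; rewrite gtr0_norm.
have big_d k : k != k0 -> e k = s -> n%:Z <= (d k)%:Z * M.
  move=> nk ek; have := noex k; rewrite ME => no.
  rewrite leNgt; apply/negP => lt_n; apply: no; split=> //; lia.
pose P k := (k != k0) && (e k == s).
(* Removing the [k0] term absorbs the [- 1], and terms with [e k] different from [s] become
   nonpositive after multiplication by [s]. *)
have M_le : M <= \sum_(k | P k) (d k)%:Z.
  have -> : M = \sum_(k | k != k0) s * e k * (d k)%:Z.
    rewrite /M NE (bigD1 k0) //= d0 e0 mul1r addrAC subrr add0r mulr_sumr.
    by apply: eq_bigr => k _; rewrite mulrA.
  rewrite big_mkcondr /=; apply: ler_sum => k _.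
  have := e1 k; case: eqP => [-> | nes] ek; first by case: s_cases => ->; lia.
  have : s * e k <= 0 by case: s_cases nes => ->; lia.
  nia.
have sq_le : \sum_(k | P k) (d k)%:Z * (d k)%:Z <= n%:Z - 1.
  have -> : n%:Z - 1 = \sum_(k | k != k0) (d k)%:Z * (d k)%:Z.
    rewrite nE (bigD1 k0) //= d0 PoszD addrAC subrr add0r (big_morph Posz PoszD erefl).
    by apply: eq_bigr => k _; rewrite -mulnn PoszM.
  rewrite big_mkcondr /=; apply: ler_sum => k _.
  by case: ifP => // _; nia.
have : M * n%:Z <= M * (n%:Z - 1).
  apply: (@le_trans _ _ (\sum_(k | P k) (d k)%:Z * n%:Z)).
    by rewrite -mulr_suml; apply: ler_wpM2r.
  apply: (@le_trans _ _ (M * \sum_(k | P k) (d k)%:Z * (d k)%:Z)); last first.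
    by rewrite ler_pM2l.
  rewrite mulr_sumr; apply: ler_sum => k /andP[nk /eqP ek].
  by have := big_d k nk ek; nia.
nia.
Qed.

Theorem theorem6p1 (R : realType) (H : hopfAlgType R[i]) (n : nat)
    (dimH : \dim {:H} = n) (even_n : ~~ odd n)
    (ssH : semisimple_algebra H) :
  exists chi : H -> R[i],
    [/\ irreducible_char chi,
        chi = dual_char chi,
        chi <> counit :> (H -> R[i]),
        char_deg chi <= (n%:R - 1) / `|lftrace (antipode : 'End(H)) - 1| &
        (1 < lftrace (antipode : 'End(H)) -> nu2 chi = 1) /\
        (lftrace (antipode : 'End(H)) < 1 -> nu2 chi = -1)].
Proof.
have [r [B [orthB sumB]]] := matrix_blocks ssH.
have [k0 [intLam d0 tr0]] := trivial_block sumB.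
have SK := antipode_involutive sumB intLam.
pose tS := lftrace (antipode : 'End(H)); rewrite -/tS.
have [m tSm _] : exists2 m : nat, tS = n%:R - (m.*2)%:R & True.
  have two0 : 2 != 0 :> R[i] by rewrite pnatr_eq0.
  have [|m tSm _] := lftrace_involution two0 (f := antipode : 'End(H)).
    by apply/lfunP => x; rewrite comp_lfunE id_lfunE; apply: SK.
  by exists m; rewrite // -dimH.
pose d k := bdeg (B k).
(* [e k] is the indicator of the [k]-th block character as an integer, obtained from the trace of
   [S] on the block. *)
have /boolp.choice[e eP] k : exists e : int,
    [/\ block_trace B k = e%:~R * (d k)%:R, `|e| <= 1 &
      e != 0 -> forall h, block_char (B k) (antipode h) = block_char (B k) h].
  case: (block_trace_cases sumB intLam k) => [t0 | [[t1|t1] dual]].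
  - by exists 0; rewrite t0 mul0r.
  - by exists 1; rewrite t1 mul1r.
  by exists (-1); rewrite t1 mulN1r.
have d_neq0 k : (d k)%:R != 0 :> R[i] by rewrite pnatr_eq0 -lt0n bdeg_gt0.
have nu2E k : nu2 (block_char (B k)) = (e k)%:~R.
  apply: (mulfI (d_neq0 k)); rewrite (nu2_block orthB sumB intLam).
  by have [-> _ _] := eP k; rewrite mulrC.
(* The trivial block is spanned by its idempotent, which is the integral and so is fixed by [S]. *)
have e0 : e k0 = 1.
  have one_i (i j : 'I_(bdeg (B k0))) : i = j.
    by move: i j; rewrite d0 => i j; rewrite !ord1.
  have [+ _ _] := eP k0; rewrite /d d0 mulr1 => te.
  have : block_trace B k0 = 1.
    rewrite /block_trace (eq_bigr (fun=> 1)) ?sumr_const ?card_ord ?d0 // => i _.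
    rewrite (eq_bigr (fun=> 1)) ?sumr_const ?card_ord ?d0 // => j _.
    have -> : delta_mx i j = 1%:M :> 'M[R[i]]_(bdeg (B k0)).
      by apply/matrixP => p q; rewrite !mxE (one_i p i) (one_i q j) (one_i i j) !eqxx.
    rewrite -/(bidem (B k0)) (antipode_integral intLam (antipode_ker0 sumB)).
    by rewrite brep_idem mxE (one_i i j) eqxx.
  rewrite te => /eqP; rewrite -[1]/(1%:~R) eqr_int => /eqP //.
pose N := \sum_k e k * (d k)%:Z.
have tSN : tS = N%:~R.
  rewrite /tS (lftrace_antipode sumB) rmorph_sum; apply: eq_bigr => k _ /=.
  by have [-> _ _] := eP k; rewrite intrM.
have nE : n = (\sum_k d k ^ 2)%N.
  apply/eqP; rewrite -(eqr_nat R[i]) natr_sum -dimH.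
  by apply/eqP; apply: sum_bdeg2.
have N_even : N = n%:Z - (m.*2)%:Z.
  by apply/eqP; rewrite -(eqr_int R[i]) -tSN tSm intrB.
pose s : int := if 1 < N then 1 else -1.
have s1 : `|s| = 1 by rewrite /s; case: ifP.
(* [N] differs from the even number [n] by [m.*2], so it is even. *)
have N_neq1 : N <> 1 by lia.
have sN : 0 < s * (N - 1) by rewrite /s; case: ifP => ?; lia.
have [|k [nk0 ek dk]] := small_degree_exists _ s1 d0 e0 nE (erefl N) sN.
  by move=> k; have [] := eP k.
have [_ _ dualk] := eP k.
exists (block_char (B k)); split.
- exact: block_char_irreducible.
- apply: funext => h; rewrite /dual_char dualk // ek.
  by rewrite -normr_eq0 s1.
(* The two characters differ on the idempotent of the trivial block: 0 by orthogonality, since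
   [k != k0], against 1. *)
- move=> chiE; have := congr1 (fun f => f (bidem (B k0))) chiE.
  rewrite /block_char /bidem (brep_bemb_neq orthB) // linear0.
  have -> : (counit (bemb (B k0) 1%:M) : R[i]) = 1 by exact: counit_integral intLam.
  by move/esym/eqP; rewrite oner_eq0.
(* All quantities are images of integers, so the comparison in [R[i]] reduces to [dk]. *)
- rewrite /char_deg /block_char brep1 mxtrace1 tSN -[1]/(1%:~R) -intrB -intr_norm.
  rewrite ler_pdivlMr ?ltr0z ?normr_gt0 ?subr_eq0; last exact/eqP.
  by rewrite pmulrn -intrM pmulrn -intrB ler_int.
rewrite nu2E ek tSN; split.
  by rewrite -[X in X < _]/(1%:~R) ltr_int => N1; rewrite /s N1.
by rewrite -[X in _ < X]/(1%:~R) ltr_int => N1; rewrite /s ltNge ltW.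
Qed.
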